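(* Let $s>2$ be a prime power. For $1<k\le (s^n-1)/(s-1)$, let $h_1,\dots,h_k$ be $k$ distinct functions in $H(X_1,\dots,X_n)$. The column juxtaposition of $Q_{h_i}(X_1,\dots,X_n)$, $i=1,\dots,k$, forms an $SSD(s^n,s^m)$ with $m=k(s^n-1)/(s-1)$. It has overall $A_2=\binom{k}{2}(s^n-1)$ and is optimal under GMA. Furthermore, there are no fully aliased columns if $s$ is odd or $s>4$. (i) For $s$ odd, the possible projected $A_2$ values are $0$, $(s-1)/s$, $(s-1)^2/s^2$ and $(s-1)/s^2$. There are $\binom{k}{2}2s$ pairs with projected $A_2=(s-1)/s$, $\binom{k}{2}s^2$ pairs with projected $A_2=(s-1)^2/s^2$ and $\binom{k}{2}s^2(s^n-s^2)/(s-1)$ pairs with projected $A_2=(s-1)/s^2$. (ii) For $s$ even, the possible projected $A_2$ values are $0,1,2$ and $3$. (iii) For $s=4$, the possible projected $A_2$ values are $0,1$ and $3$. There are $\binom{k}{2}$ pairs of fully aliased columns with projected $A_2=3$ and $\binom{k}{2}(4^n-4)$ pairs of partially aliased columns with projected $A_2=1$.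
   Context: Designs: $SSD(N,s^m)$ denotes an $N\times m$ matrix $D=[x_{ik}]$ with entries in a set of $s$ symbols (here the finite field $F_s$ with $s$ elements), which is balanced: in every column each symbol appears exactly $N/s$ times. Generalized wordlength pattern: choose orthonormal contrasts on the symbol set, i.e. complex-valued functions $c_1,\dots,c_{s-1}$ on the symbols with $\sum_x c_a(x)=0$ and $\sum_x c_a(x)\overline{c_b(x)}=s$ if $a=b$ and $0$ otherwise. For $j=1,\dots,m$, $$A_j(D)=N^{-2}\sum_{K\subseteq\{1,\dots,m\},\,|K|=j}\ \sum_{(a_k)_{k\in K}\in\{1,\dots,s-1\}^K}\Big|\sum_{i=1}^N\prod_{k\in K}c_{a_k}(x_{ik})\Big|^2 ,$$ independently of the choice of contrasts. The overall $A_2$ is $A_2(D)$; the projected $A_2$ value of a pair of columns is $A_2$ of the two-column design they form. $D$ is optimal under GMA (generalized minimum aberration) if there is no $SSD(N,s^m)$ $D'$ and index $r$ with $A_j(D')=A_j(D)$ for all $j<r$ and $A_r(D')<A_r(D)$. Polynomial columns: a function $f(X_1,\dots,X_n)$ on $F_s^n$ gives a column of length $s^n$, rows being indexed by the points of $F_s^n$; a set of functions gives the design with the corresponding columns. $H(X_1,\dots,X_n)$ is the set of nonzero linear forms $c_1X_1+\cdots+c_nX_n$ ($c_i\in F_s$) whose last nonzero coefficient is $1$. For any variables (independent linear forms) $Y_1,\dots,Y_n$, $Q_1^*(Y_1,\dots,Y_n)=\{Y_1^2+aY_1+g: a\in F_s,\ g\in H(Y_2,\dots,Y_n)\}$ and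 $Q_1(Y_1,\dots,Y_n)=\{Y_1\}\cup Q_1^*(Y_1,\dots,Y_n)$, where $H(Y_2,\dots,Y_n)$ is the set of nonzero linear forms in $Y_2,\dots,Y_n$ whose last nonzero coefficient is $1$. For $h=c_1X_1+\cdots+c_nX_n\in H(X_1,\dots,X_n)$, let $l$ be the largest index with $c_l\ne0$ (so $c_l=1$), put $Y_1=h$, $Y_i=X_{i-1}$ for $2\le i\le l$, $Y_i=X_i$ for $l<i\le n$, and define $Q_h(X_1,\dots,X_n)=Q_1(Y_1,\dots,Y_n)$ (as functions on $F_s^n$ in $X_1,\dots,X_n$). Two columns of length $s^n$ are fully aliased if the pair has only $s$ distinct level combinations, each occurring $s^{n-1}$ times (equivalently projected $A_2=s-1$); orthogonal if it has $s^2$ distinct level combinations, each occurring $s^{n-2}$ times (projected $A_2=0$); partially aliased if neither orthogonal nor fully aliased. *)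

(* Defs.v *)
From HB Require Import structures.
From mathcomp Require Import all_boot all_order all_algebra.
From mathcomp Require Export reals complex.

Set Implicit Arguments.
Unset Strict Implicit.
Unset Printing Implicit Defensive.

Import Order.TTheory GRing.Theory Num.Theory.
Local Open Scope ring_scope.

(* A design with N runs, m factors and symbol set S is a matrix 'M[S]_(N, m);
   it is an SSD(N, s^m), with s = #|S|, when it is balanced. *)
Definition balanced (S : finType) (N m : nat) (D : 'M[S]_(N, m)) : Prop :=
  forall (j : 'I_m) (x : S), #|[set i : 'I_N | D i j == x]| = (N %/ #|S|)%N.

Definition orthonormal_contrasts (C : numClosedFieldType) (S : finType)
    (c : 'I_(#|S|.-1) -> S -> C) : Prop :=
  (forall a, \sum_x c a x = 0) /\
  (forall a b, \sum_x c a x * (c b x)^* = if a == b then #|S|%:R else 0).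

(* A choice (a_k)_(k in K) is a finite function on the subtype of K. *)
Definition gwlp (C : numClosedFieldType) (S : finType)
    (c : 'I_(#|S|.-1) -> S -> C) (N m : nat) (D : 'M[S]_(N, m)) (j : nat) : C :=
  N%:R ^- 2 *
  \sum_(K : {set 'I_m} | #|K| == j)
    \sum_(a : {ffun {k : 'I_m | k \in K} -> 'I_(#|S|.-1)})
      `| \sum_(i < N) \prod_(k : {k : 'I_m | k \in K}) c (a k) (D i (val k)) | ^+ 2.

Definition GMA_optimal (C : numClosedFieldType) (S : finType)
    (c : 'I_(#|S|.-1) -> S -> C) (N m : nat) (D : 'M[S]_(N, m)) : Prop :=
  ~ exists (D' : 'M[S]_(N, m)) (r : nat),
      [/\ balanced D',
          (0 < r <= m)%N,
          forall j, (0 < j < r)%N -> gwlp c D' j = gwlp c D j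
        & gwlp c D' r < gwlp c D r].

Definition projA2 (C : numClosedFieldType) (S : finType)
    (c : 'I_(#|S|.-1) -> S -> C) (N m : nat) (D : 'M[S]_(N, m)) (u v : 'I_m) : C :=
  gwlp c (row_mx (col u D) (col v D)) 2.

Definition level_count (S : finType) (N m : nat) (D : 'M[S]_(N, m))
    (u v : 'I_m) (xy : S * S) : nat :=
  #|[set i : 'I_N | (D i u, D i v) == xy]|.

(* The pair of columns u, v has exactly t distinct level combinations, each
   occurring N / t times. *)
Definition equal_levels (S : finType) (N m : nat) (D : 'M[S]_(N, m))
    (u v : 'I_m) (t : nat) : bool :=
  let L := [set (D i u, D i v) | i : 'I_N] in
  (#|L| == t) && [forall xy in L, level_count D u v xy == (N %/ t)%N].

Definition fully_aliased (S : finType) (N m : nat) (D : 'M[S]_(N, m))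
    (u v : 'I_m) : bool := equal_levels D u v #|S|.

Definition orthogonal_cols (S : finType) (N m : nat) (D : 'M[S]_(N, m))
    (u v : 'I_m) : bool := equal_levels D u v (#|S| ^ 2)%N.

Definition partially_aliased (S : finType) (N m : nat) (D : 'M[S]_(N, m))
    (u v : 'I_m) : bool := ~~ orthogonal_cols D u v && ~~ fully_aliased D u v.

Definition npairs (m : nat) (P : 'I_m -> 'I_m -> bool) : nat :=
  #|[set p : 'I_m * 'I_m | (p.1 < p.2)%N && P p.1 p.2]|.

Notation pfun F n := {ffun 'rV[F]_n -> F}.

Definition X_ (F : finFieldType) (n : nat) (i : 'I_n) : pfun F n :=
  [ffun x : 'rV[F]_n => x 0 i].

Definition last_coef1 (F : finFieldType) (p : nat) (c : 'I_p -> F) : bool :=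
  [exists l : 'I_p, (c l == 1) && [forall j : 'I_p, (l < j)%N ==> (c j == 0)]].

Definition Hset (F : finFieldType) (n p : nat) (Y : 'I_p -> pfun F n) :
    {set pfun F n} :=
  [set [ffun x : 'rV[F]_n => \sum_(i < p) c i * Y i x]
     | c : {ffun 'I_p -> F} in [pred c : {ffun 'I_p -> F} | last_coef1 c]].

(* The first variable Y1 is separated from the remaining ones, Y. *)
Definition Q1 (F : finFieldType) (n p : nat) (Y1 : pfun F n)
    (Y : 'I_p -> pfun F n) : {set pfun F n} :=
  Y1 |: [set [ffun x : 'rV[F]_n => Y1 x ^+ 2 + a * Y1 x + g x]
           | a : F in [set: F], g : pfun F n in Hset Y].

(* The coefficient of X_i in a linear form h is its value at the i-th unit
   vector. *)
Definition coefX (F : finFieldType) (n : nat) (h : pfun F n) (i : 'I_n) : F :=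
  h (delta_mx 0 i).

Definition last_index (F : finFieldType) (n : nat) (h : pfun F n) (l : 'I_n) : bool :=
  (coefX h l != 0) && [forall j : 'I_n, (l < j)%N ==> (coefX h j == 0)].

(* Y_2, ..., Y_n is X_1, ..., X_n with X_l omitted, i.e. X_ \o lift l.  The
   index l always exists when h is a nonzero linear form. *)
Definition Qh (F : finFieldType) (n : nat) (h : pfun F n) : {set pfun F n} :=
  if [pick l : 'I_n | last_index h l] is Some l
  then Q1 h (fun i : 'I_n.-1 => X_ F (lift l i)) else set0.

Definition cols_design (F : finFieldType) (n : nat) (cs : seq (pfun F n)) :
    'M[F]_(#|{: 'rV[F]_n}|, size cs) :=
  \matrix_(i, j) tnth (in_tuple cs) j (enum_val i).

Definition juxta_cols (F : finFieldType) (n k : nat) (h : 'I_k -> pfun F n) :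
    seq (pfun F n) :=
  flatten [seq enum (Qh (h i)) | i <- enum 'I_k].

(* Main.v *)
Require Import Defs.
From mathcomp Require Import all_boot all_order all_algebra all_field.
From mathcomp Require Import ring zify.
Import Order.TTheory GRing.Theory Num.Theory.
Set Implicit Arguments.
Unset Strict Implicit.
Unset Printing Implicit Defensive.
Local Open Scope ring_scope.

(** Write q for the order of the field F and N = q^n for the number of runs;
    the rows are the points of V = F^n.

    Averaging over orthonormal contrasts turns A_j of a design into
    N^-2 times the sum, over ordered pairs of rows, of the j-th elementary
    symmetric function of the numbers q [x_k = y_k] - 1, k ranging over the
    columns ([gwlpE]).  So A_j depends only on the numbers of coincidences of
    the pairs of rows, and for balanced designs A_2 is, up to affine
    normalization, the sum of the squares of these numbers, whose total is
    fixed.  A balanced design in which any two distinct rows coincide equally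
    often therefore minimizes A_2, and every balanced design with the same A_2
    has the same coincidence numbers, hence the same A_j for all j:
    such a design is GMA optimal ([constant_row_weight_GMA]), and its A_2 is
    explicit ([constant_row_weight_gwlp2]).

    Each Q_h has this property.  If h(x) = h(y), then x and y coincide
    in h and in h^2 + a h + g for all a and all g with g(x) = g(y); if
    h(x) <> h(y), then for each g there is exactly one a.  Both counts are
    (q^(n-1) - 1) / (q - 1) ([block_coincidence]).  This gives everything about
    the whole design.

    For two balanced functions f, f', the projected value is
    q^2 M / N^2 - 1 with M the number of (x, y) such that f(x) = f(y) and
    f'(x) = f'(y).  It vanishes when one of the two grows linearly along a line
    on which the other is constant ([fA2_slope]); this settles the pairs inside
    one Q_h, since h^2 + a h + g and h^2 + b h + g with a <> b determine the
    same partition of V as h and h^2 + a h + g.  For h <> h', consider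
    h^2 + a h + g in Q_h and h'^2 + a' h' + g' in Q_h'.  What matters is whether g and g' vanish on the intersection of ker h and
    ker h'; exactly one normalized g that is free of the last variable of h does
    ([unique_vanishing_dir]).

    - q odd: for each difference v the equation f(y + v) = f(y) is affine in y,
      so M is a sum over v of sizes of affine subspaces, which yields the
      four possible values.  The first two multiplicities are counted directly, the
      third one follows from the total A_2.
    - q even: all columns are additive, the projected value plus 1 is
      q^2 / |image of (f, f')|, a power of 2.  On a plane where (h, h') is a
      bijection onto F^2 the equations f = f' = 0 become a pair of conics
      with at most four common points ([card_conics]), so that this power of 2
      is at most 4.
    - q = 4: the value is 3 iff ker f is contained in ker f'.  This forces g
      and g' to be combinations of h and h', say g = al h + nu h' and
      g' = nu h + be h', and then a = al, a' = be.  The coefficient nu is the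
      same on both sides because of the normalization of the forms
      ([common_normalization]).  So each pair h, h' contributes exactly
      one fully aliased pair, and the number of values 1 follows from the
      total A_2. *)

(** * The wordlength pattern as a sum over pairs of rows *)

Section Contrasts.

Variables (C : numClosedFieldType) (S : finType).
Variable c : 'I_(#|S|.-1) -> S -> C.
Hypothesis hc : orthonormal_contrasts c.
Hypothesis hS : (0 < #|S|)%N.

Local Notation q := (#|S|%:R : C).

(** Orthonormality of the rows of a square matrix, read on its columns: the
    contrasts and the constant function 1 form, up to scaling, a unitary matrix. *)
Lemma contrast_dual (x y : S) :
  \sum_a c a x * (c a y)^* = q * (x == y)%:R - 1.
Proof.
case: hc => c_sum c_orth.
(* The rows of U are the constant 1 and the contrasts. *)
pose U : 'M[C]_(1 + #|S|.-1, #|S|) :=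
  col_mx (const_mx 1) (\matrix_(a, j) c a (enum_val j)).
pose V : 'M[C]_(#|S|, 1 + #|S|.-1) :=
  row_mx (const_mx 1) (\matrix_(j, a) (c a (enum_val j))^*).
have sumS (G : S -> C) : \sum_(j < #|S|) G (enum_val j) = \sum_z G z.
  by rewrite -(big_enum_val (A := {: S}) G).
have c_sum' a : \sum_z (c a z)^* = 0.
  by rewrite -rmorph_sum c_sum rmorph0.
have UV : U *m V = q%:M.
  rewrite mul_col_row -[RHS](@submxK _ 1 _ 1).
  congr block_mx; apply/matrixP => i j; rewrite !mxE.
  - under eq_bigr do rewrite !mxE mul1r.
    by rewrite sumr_const card_ord !ord1 eqxx.
  - under eq_bigr do rewrite !mxE mul1r.
    by rewrite (sumS (fun z => (c j z)^*)) c_sum' eq_lrshift.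
  - under eq_bigr do rewrite !mxE mulr1.
    by rewrite (sumS (c i)) c_sum eq_rlshift.
  - under eq_bigr do rewrite !mxE.
    by rewrite (sumS (fun z => c i z * (c j z)^*)) c_orth eq_rshift; case: eqP.
have q0 : q != 0 by rewrite pnatr_eq0 -lt0n.
have dim : (1 + #|S|.-1 = #|S|)%N by rewrite add1n prednK.
have VU : V *m U = q%:M.
  have: (U *m (q^-1 *: V)) = 1%:M.
    by rewrite -scalemxAr UV scale_scalar_mx mulVf.
  move: U V {UV}; rewrite dim => U V /mulmx1C.
  rewrite -scalemxAl => /(congr1 (fun M => q *: M)).
  by rewrite scalerA divff // scale1r scale_scalar_mx mulr1.
have := congr1 (fun M : 'M_ _ => M (enum_rank y) (enum_rank x)) VU.
rewrite mul_row_col !mxE big_ord1 !mxE mulr1.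
under eq_bigr do rewrite !mxE !enum_rankK mulrC.
move=> E; apply: (@addrI _ 1); rewrite E addrC subrK (can_eq enum_rankK) eq_sym.
by case: eqP; rewrite ?mulr1 ?mulr0.
Qed.

(** The value of the sum over a of c_a(x) times the conjugate of c_a(y), as a
    function of the truth value b of x = y. *)
Definition agree_weight (b : bool) : C := q * b%:R - 1.

Lemma gwlpE N m (D : 'M[S]_(N, m)) j :
  gwlp c D j = N%:R ^- 2 * \sum_i \sum_i' \sum_(K : {set 'I_m} | #|K| == j)
     \prod_(k in K) agree_weight (D i k == D i' k).
Proof.
rewrite /gwlp; congr (_ * _).
under [RHS]eq_bigr do rewrite exchange_big.
rewrite [RHS]exchange_big /=; apply: eq_bigr => K _.
transitivity (\sum_(a : {ffun {k : 'I_m | k \in K} -> 'I_(#|S|.-1)})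
  \sum_i \sum_i' \prod_(k : {k : 'I_m | k \in K})
    (c (a k) (D i (val k)) * (c (a k) (D i' (val k)))^*)).
  apply: eq_bigr => a _; rewrite normCK rmorph_sum big_distrlr /=.
  apply: eq_bigr => i _; apply: eq_bigr => i' _.
  by rewrite rmorph_prod -big_split.
rewrite exchange_big; apply: eq_bigr => i _.
rewrite exchange_big; apply: eq_bigr => i' _ /=.
rewrite -(bigA_distr_bigA (fun k a => c a (D i (val k)) * (c a (D i' (val k)))^*)).
rewrite [RHS]big_sub /=; apply: eq_bigr => k _.
exact: contrast_dual.
Qed.

End Contrasts.

Lemma sum_card2 (V : nmodType) m (G : {set 'I_m} -> V) :
  \sum_(K : {set 'I_m} | #|K| == 2) G K =
  \sum_(p : 'I_m * 'I_m | (p.1 < p.2)%N) G [set p.1; p.2].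
Proof.
rewrite [RHS](partition_big (fun p : 'I_m * 'I_m => [set p.1; p.2])
                            (fun K : {set 'I_m} => #|K| == 2)) /=; last first.
  by case=> u v /= uv; rewrite cards2 neq_ltn uv.
apply: eq_bigr => _ /cards2P[x [y [nxy ->]]].
wlog xy : x y nxy / (x < y)%N.
  move=> th; have := nxy; rewrite neq_ltn => /orP[] xy; first exact: th.
  by rewrite setUC; apply: th; rewrite 1?eq_sym.
rewrite (big_pred1 (x, y)) // => -[u v] /=; rewrite xpair_eqE.
apply/andP/andP => [[uv /eqP E]|[/eqP-> /eqP->]] //.
have: u \in [set x; y] by rewrite -E !inE eqxx.
have: v \in [set x; y] by rewrite -E !inE eqxx orbT.
rewrite !inE => /orP[] /eqP ? /orP[] /eqP ?; subst; rewrite ?eqxx ?ltnn // in uv *.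
by have := ltn_trans xy uv; rewrite ltnn.
Qed.

Lemma big_pair_set2 (C : comNzRingType) m (w : 'I_m -> C) (u v : 'I_m) :
  (u < v)%N -> \prod_(k in [set u; v]) w k = w u * w v.
Proof. by move=> uv; rewrite big_setU1 ?big_set1 // inE neq_ltn uv. Qed.

(** The second elementary symmetric function from the power sums. *)
Lemma sum_pairs_sqr (C : comNzRingType) m (w : 'I_m -> C) :
  (\sum_u w u) ^+ 2 =
  \sum_u w u ^+ 2 + (\sum_(p : 'I_m * 'I_m | (p.1 < p.2)%N) w p.1 * w p.2) *+ 2.
Proof.
rewrite expr2 big_distrlr /= pair_big /= (bigID (fun p : 'I_m * 'I_m => p.1 == p.2)) /=.
congr (_ + _).
  rewrite -(pair_big_dep xpredT (fun u v => u == v) (fun u v => w u * w v)) /=.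
  by apply: eq_bigr => u _; rewrite (big_pred1 u) // => v; rewrite eq_sym.
rewrite (bigID (fun p : 'I_m * 'I_m => (p.1 < p.2)%N)) /= mulr2n; congr (_ + _).
  by apply: eq_bigl => -[u v] /=; rewrite neq_ltn; case: ltngtP.
rewrite (reindex_inj (inv_inj swap_pairK)) /=.
apply: eq_big => [[u v] /=|[u v] /= _]; last by rewrite mulrC.
by rewrite neq_ltn; case: ltngtP.
Qed.

(** * Designs with constant row coincidence *)

Lemma card_set_sum (T : finType) (b : pred T) : #|[set k | b k]| = (\sum_k b k)%N.
Proof. by rewrite -sum1dep_card big_mkcond. Qed.

Section ConstantCoincidence.

Variables (C : numClosedFieldType) (S : finType).
Variable c : 'I_(#|S|.-1) -> S -> C.
Hypothesis hc : orthonormal_contrasts c.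
Hypothesis hS : (1 < #|S|)%N.
Variables N m : nat.
Hypothesis qN : (#|S| %| N)%N.
Hypothesis N0 : (0 < N)%N.

Local Notation q := (#|S|%:R : C).
Local Notation w := (agree_weight C S).
Implicit Type D : 'M[S]_(N, m).

(** q times the number of columns in which the rows i and i' agree, minus the
    number of columns. *)
Definition row_weight D (i i' : 'I_N) : C := \sum_k w (D i k == D i' k).

Lemma row_weightE D i i' :
  row_weight D i i' = q * #|[set k | D i k == D i' k]|%:R - m%:R.
Proof.
rewrite /row_weight sumrB -mulr_sumr sumr_const card_ord -natr_sum.
by rewrite card_set_sum.
Qed.

Lemma row_weight_diag D i : row_weight D i i = (q - 1) * m%:R.
Proof.
rewrite row_weightE (_ : [set k | _] = setT) ?cardsT ?card_ord; first ring.
by apply/setP => k; rewrite !inE eqxx.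
Qed.

Lemma sum_coincidence (T : finType) (f : T -> S) (r : nat) :
  (forall x, #|[set i | f i == x]| = r) ->
  \sum_i \sum_i' (f i == f i')%:R = (#|S| * r ^ 2)%:R :> C.
Proof.
move=> bal; rewrite (partition_big f xpredT) //=.
rewrite (eq_bigr (fun _ => (r ^ 2)%:R)) => [|x _].
  by rewrite sumr_const -mulrnA mulnC.
rewrite (eq_bigr (fun _ => r%:R)) => [|i _].
  by rewrite sumr_const -(bal x) cardsE -mulrnA.
rewrite -natr_sum -(bal (f i)) card_set_sum.
by congr (_%:R); apply: eq_bigr => i' _; rewrite eq_sym.
Qed.

Lemma sum_agree_weight D k : balanced D ->
  \sum_i \sum_i' w (D i k == D i' k) = 0.
Proof.
move=> bal; under eq_bigr do rewrite sumrB -mulr_sumr sumr_const card_ord.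
rewrite sumrB -mulr_sumr (sum_coincidence (r := N %/ #|S|)); last exact: bal.
rewrite sumr_const card_ord -mulrnA -natrM; apply/eqP; rewrite subr_eq0 eqr_nat.
by case/dvdnP: qN => e ->; rewrite mulnK ?(ltnW hS) //; apply/eqP; ring.
Qed.

Lemma gwlp1_eq0 D : balanced D -> gwlp c D 1 = 0.
Proof.
move=> bal; rewrite (gwlpE hc) ?(ltnW hS) //.
under eq_bigr do rewrite exchange_big.
rewrite exchange_big big1 ?mulr0 //= => _ /cards1P[k ->].
rewrite -[RHS](sum_agree_weight k bal).
by do 2!apply: eq_bigr => ? _; rewrite big_set1.
Qed.

Lemma sum_row_weight D : balanced D -> \sum_i \sum_i' row_weight D i i' = 0.
Proof.
move=> bal; under eq_bigr do rewrite exchange_big.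
by rewrite exchange_big big1 //= => k _; apply: sum_agree_weight.
Qed.

Lemma agree_weight_sqr b : w b ^+ 2 = (q - 2) * w b + (q - 1).
Proof. by case: b; rewrite /agree_weight ?mulr1 ?mulr0; ring. Qed.

Lemma gwlp2_row_weight D : balanced D ->
  gwlp c D 2 *+ 2 =
  N%:R ^- 2 * (\sum_i \sum_i' row_weight D i i' ^+ 2 - (q - 1) * m%:R * N%:R ^+ 2).
Proof.
move=> bal; rewrite (gwlpE hc) ?(ltnW hS) // -mulrnAr; congr (_ * _).
transitivity (\sum_i \sum_i' (row_weight D i i' ^+ 2
    - \sum_k w (D i k == D i' k) ^+ 2)).
  rewrite -sumrMnl; apply: eq_bigr => i _.
  rewrite -sumrMnl; apply: eq_bigr => i' _.
  rewrite sum_pairs_sqr addrAC subrr add0r sum_card2; congr (_ *+ 2).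
  by apply: eq_bigr => p lt_p; rewrite big_pair_set2.
under eq_bigr do rewrite sumrB.
rewrite sumrB; congr (_ - _).
transitivity (\sum_i \sum_i' ((q - 2) * row_weight D i i' + (q - 1) * m%:R)).
  apply: eq_bigr => i _; apply: eq_bigr => i' _.
  under eq_bigr do rewrite agree_weight_sqr.
  by rewrite big_split /= -mulr_sumr sumr_const card_ord mulr_natr.
under eq_bigr do rewrite big_split /= -mulr_sumr sumr_const card_ord.
rewrite big_split /= -mulr_sumr sum_row_weight // sumr_const card_ord.
by rewrite mulr0 add0r -mulrnA -[LHS]mulr_natr natrM.
Qed.

(** The j-th elementary symmetric function of m numbers taking two values is a
    coefficient of a product of powers of two linear polynomials; it depends
    only on how often each value is taken. *)
Lemma gwlp_eq_row_weight D D' j :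
  (forall i i', row_weight D i i' = row_weight D' i i') ->
  gwlp c D j = gwlp c D' j.
Proof.
move=> E; rewrite !(gwlpE hc) ?(ltnW hS) //; congr (_ * _).
apply: eq_bigr => i _; apply: eq_bigr => i' _.
have Ecard : #|[set k | D i k == D i' k]| = #|[set k | D' i k == D' i' k]|.
  have := E i i'; rewrite !row_weightE => /addIr/(mulfI _) H.
  by apply/eqP; rewrite -(eqr_nat C) H // pnatr_eq0 -lt0n (ltnW hS).
(* Generating function of the elementary symmetric functions of the weights. *)
have genf (b : 'I_m -> bool) :
    \sum_(K : {set 'I_m} | #|K| == j) \prod_(k in K) w (b k) =
    ((1 + w true *: 'X) ^+ #|[set k | b k]|
      * (1 + w false *: 'X) ^+ (m - #|[set k | b k]|))`_j.
  transitivity ((\prod_k (1 + w (b k) *: 'X))`_j); last first.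
    rewrite (bigID b) /=; congr ((_ * _ : {poly C})`_j).
      rewrite (eq_bigr (fun=> 1 + w true *: 'X)) => [|k -> //].
      by rewrite prodr_const cardsE.
    rewrite (eq_bigr (fun=> 1 + w false *: 'X)) => [|k /negPf-> //].
    rewrite prodr_const; congr (_ ^+ _).
    rewrite -[LHS](addKn #|b|) cardsE; congr (_ - _)%N.
    by rewrite -[RHS](card_ord m) -(cardC b).
  rewrite (eq_bigr (fun k => w (b k) *: 'X + 1)) => [|k _]; last exact: addrC.
  rewrite bigA_distr coef_sum big_mkcond /=; apply: eq_bigr => K _.
  rewrite -big_mkcond /= scaler_prod prodr_const coefZ coefXn eq_sym.
  by case: eqP; rewrite ?mulr1 ?mulr0.
by rewrite !genf Ecard.
Qed.

(** The difference of the A_2 of a balanced competitor and that of D is a positive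
    multiple of the sum of the squares of the differences of row weights. *)
Theorem constant_row_weight_GMA D (omega : C) : balanced D ->
  (forall i i', i != i' -> row_weight D i i' = omega) -> GMA_optimal c D.
Proof.
move=> bal Dw [D' [r [bal' r_bd eq_lt lt_r]]].
have N2 : N%:R ^+ 2 != 0 :> C by rewrite expf_neq0 // pnatr_eq0 -lt0n.
have offdiag (G : 'I_N -> 'I_N -> C) :
    \sum_i \sum_i' G i i' = \sum_i G i i + \sum_i \sum_(i' | i' != i) G i i'.
  by rewrite -big_split; apply: eq_bigr => i _; rewrite (bigD1 i).
(* Balance fixes the sum of the off-diagonal row weights. *)
have sum_off : \sum_i \sum_(i' | i' != i) row_weight D' i i' =
               \sum_(i < N) \sum_(i' < N | i' != i) omega.
  have: injective (+%R (\sum_(i < N) (q - 1) * m%:R : C)) by apply: addrI.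
  apply; transitivity (0 : C).
    rewrite -[RHS](sum_row_weight bal') offdiag; congr (_ + _).
    by apply: eq_bigr => i _; rewrite row_weight_diag.
  rewrite -[LHS](sum_row_weight bal) offdiag; congr (_ + _).
    by apply: eq_bigr => i _; rewrite row_weight_diag.
  by apply: eq_bigr => i _; apply: eq_bigr => i' ne; rewrite Dw // eq_sym.
have diff2 : (gwlp c D' 2 - gwlp c D 2) *+ 2 =
    N%:R ^- 2 * \sum_i \sum_(i' | i' != i) (row_weight D' i i' - omega) ^+ 2.
  rewrite mulrnBl !gwlp2_row_weight // -mulrBr; congr (_ * _).
  rewrite opprB addrA subrK !offdiag opprD addrACA.
  rewrite [X in X + _](_ : _ = 0) ?add0r; last first.
    by rewrite -sumrB big1 // => i _; rewrite !row_weight_diag subrr.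
  transitivity (\sum_i \sum_(i' | i' != i) (row_weight D' i i' ^+ 2 - omega ^+ 2)).
    rewrite -sumrB; apply: eq_bigr => i _.
    by rewrite -sumrB; apply: eq_bigr => i' ne; rewrite Dw // eq_sym.
  apply/eqP; rewrite -subr_eq0; apply/eqP.
  transitivity (2 * omega * (\sum_i \sum_(i' | i' != i) row_weight D' i i'
                 - \sum_(i < N) \sum_(i' < N | i' != i) omega)); last first.
    by rewrite sum_off subrr mulr0.
  rewrite -!sumrB mulr_sumr; apply: eq_bigr => i _.
  rewrite -!sumrB mulr_sumr; apply: eq_bigr => i' _; ring.

have real_diff i i' : i' != i -> 0 <= (row_weight D' i i' - omega) ^+ 2.
  move=> ne; rewrite -(Dw i i') 1?eq_sym // !row_weightE -realEsqr.
  by rewrite !(rpredB, rpredM, realn).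
have [r_lt3|r_ge3] := ltnP r 3.
  have [r1|r2] : r = 1%N \/ r = 2%N by lia.
    by move: lt_r; rewrite r1 !gwlp1_eq0 ?ltxx.
  move: lt_r; rewrite r2 -subr_lt0 -(pmulrn_llt0 _ (ltn0Sn 1)) diff2.
  rewrite le_gtF // mulr_ge0 ?invr_ge0 ?exprn_ge0 ?ler0n //.
  by do 2!apply: sumr_ge0 => ? ?; apply: real_diff.
move: lt_r; rewrite (@gwlp_eq_row_weight D' D) ?ltxx // => i i'.
have [<-|ne] := eqVneq i i'; first by rewrite !row_weight_diag.
move: diff2; rewrite eq_lt // subrr mul0rn => /esym/eqP.
rewrite mulf_eq0 invr_eq0 (negPf N2) /= psumr_eq0; last first.
  by move=> j _; apply: sumr_ge0 => ? ?; apply: real_diff.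
move=> /allP/(_ i (mem_index_enum _)) /=; rewrite psumr_eq0; last first.
  by move=> j; apply: real_diff.
move=> /allP/(_ i' (mem_index_enum _)) /=; rewrite eq_sym ne sqrf_eq0 subr_eq0.
by move=> /eqP->; rewrite Dw.
Qed.

Lemma constant_row_weight_gwlp2 D (k : nat) : balanced D ->
  (m * (#|S| - 1) = k * (N - 1))%N ->
  (forall i i', i != i' -> row_weight D i i' = - k%:R) ->
  gwlp c D 2 = ('C(k, 2) * (N - 1))%:R.
Proof.
move=> bal mk Dw; apply: (@mulIf _ 2); first by rewrite pnatr_eq0.
rewrite !mulr_natr gwlp2_row_weight //.
have N2 : N%:R != 0 :> C by rewrite pnatr_eq0 -lt0n.
have mkC : (q - 1) * m%:R = k%:R * (N%:R - 1) :> C.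
  have := congr1 (fun n => n%:R : C) mk.
  by rewrite !natrM !natrB ?(ltnW hS) // mulrC.
have -> : \sum_i \sum_i' row_weight D i i' ^+ 2 =
    \sum_(i < N) (((q - 1) * m%:R) ^+ 2 + \sum_(i' < N | i' != i) k%:R ^+ 2).
  apply: eq_bigr => i _; rewrite (bigD1 i) //= row_weight_diag; congr (_ + _).
  by apply: eq_bigr => i' ne; rewrite Dw 1?eq_sym // sqrrN.
under eq_bigr => i _.
  rewrite sumr_const (_ : #|_| = N - 1)%N; last first.
    by rewrite subn1 -[in RHS](card_ord N) -(cardC1 i).
  over.
rewrite sumr_const card_ord mkC -[_ *+ N]mulr_natr -[_ *+ (N - 1)]mulr_natr.
rewrite natrB // -mulrnA mulnAC natrM natrB //.
have -> : ('C(k, 2) * 2)%:R = k%:R * (k%:R - 1) :> C.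
  case: k {mk Dw mkC} => [|k]; first by rewrite mul0r.
  rewrite bin2 /= muln2 halfK oddM /= andNb subn0 natrM; congr (_ * _).
  by rewrite -(natrB C (ltn0Sn k)) subn1.
by field; rewrite N2.
Qed.

End ConstantCoincidence.

(** * Projected values and sums over pairs of columns *)

Section ProjectedA2.

Variables (C : numClosedFieldType) (S : finType).
Variable c : 'I_(#|S|.-1) -> S -> C.
Hypothesis hc : orthonormal_contrasts c.
Hypothesis hS : (1 < #|S|)%N.

Local Notation q := (#|S|%:R : C).
Local Notation w := (agree_weight C S).

Lemma projA2_weight N m (D : 'M[S]_(N, m)) u v :
  projA2 c D u v =
  N%:R ^- 2 * \sum_i \sum_i' w (D i u == D i' u) * w (D i v == D i' v).
Proof.
rewrite /projA2 (gwlpE hc) ?(ltnW hS) //; congr (_ * _).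
apply: eq_bigr => i _; apply: eq_bigr => i' _.
rewrite sum_card2 (big_pred1 (lshift 1 ord0, rshift 1 ord0)) => [|[a b] /=].
  by rewrite big_pair_set2 //= !row_mxEl !row_mxEr !mxE.
by rewrite xpair_eqE; case: a b => [[|[|a]] ?] [[|[|b]] ?].
Qed.

Lemma gwlp2_projA2 N m (D : 'M[S]_(N, m)) :
  gwlp c D 2 = \sum_(p : 'I_m * 'I_m | (p.1 < p.2)%N) projA2 c D p.1 p.2.
Proof.
rewrite (gwlpE hc) ?(ltnW hS) //.
under [RHS]eq_bigr do rewrite projA2_weight.
rewrite -mulr_sumr; congr (_ * _); rewrite [RHS]exchange_big.
apply: eq_bigr => i _; rewrite [RHS]exchange_big; apply: eq_bigr => i' _.
by rewrite sum_card2; apply: eq_bigr => p lt_p; rewrite big_pair_set2.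
Qed.

Lemma projA2_count N m (D : 'M[S]_(N, m)) u v :
  (#|S| %| N)%N -> (0 < N)%N -> balanced D ->
  projA2 c D u v = q ^+ 2 *
    #|[set p : 'I_N * 'I_N | (D p.1 u == D p.2 u) && (D p.1 v == D p.2 v)]|%:R
      / N%:R ^+ 2 - 1.
Proof.
move=> qN N0 bal; rewrite projA2_weight.
have N2 : N%:R != 0 :> C by rewrite pnatr_eq0 -lt0n.
transitivity (N%:R ^- 2 * (\sum_i \sum_i'
    (q ^+ 2 * ((D i u == D i' u) && (D i v == D i' v))%:R
     - (w (D i u == D i' u) + w (D i v == D i' v)) - 1))).
  congr (_ * _); apply: eq_bigr => i _; apply: eq_bigr => i' _.
  rewrite /agree_weight.
  by case: (_ == _); case: (_ == _) => /=; rewrite ?mulr1 ?mulr0; ring.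
under eq_bigr do rewrite !sumrB -mulr_sumr sumr_const card_ord big_split.
rewrite !sumrB -mulr_sumr sumr_const card_ord big_split /=.
rewrite !(sum_agree_weight C hS qN) // addr0 subr0 pair_big -natr_sum /=.
rewrite -(card_set_sum (fun p : 'I_N * 'I_N =>
   (D p.1 u == D p.2 u) && (D p.1 v == D p.2 v))) -mulrnA natrM.
by field.
Qed.

End ProjectedA2.

Section PairSums.

Variable T : Type.

(** The sum of G over the pairs of entries of s, taken at increasing positions. *)
Fixpoint pair_sum (V : nmodType) (G : T -> T -> V) (s : seq T) : V :=
  if s is x :: s' then \sum_(y <- s') G x y + pair_sum G s' else 0.

Variable V : nmodType.
Implicit Type G : T -> T -> V.

Lemma pair_sumE G (s : seq T) :
  \sum_(p : 'I_(size s) * 'I_(size s) | (p.1 < p.2)%N)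
     G (tnth (in_tuple s) p.1) (tnth (in_tuple s) p.2) = pair_sum G s.
Proof.
rewrite -(pair_big_dep xpredT (fun u v : 'I_(size s) => (u < v)%N)
  (fun u v => G (tnth (in_tuple s) u) (tnth (in_tuple s) v))) /=.
elim: s => [|x s IHs] /=; first by rewrite big_ord0.
rewrite big_ord_recl; congr (_ + _).
  rewrite big_mkcond big_ord_recl /= add0r [RHS]big_tnth.
  by apply: eq_bigr => i _; rewrite !(tnth_nth x).
rewrite -IHs; apply: eq_bigr => u _.
rewrite big_mkcond big_ord_recl /= add0r [RHS]big_mkcond.
by apply: eq_bigr => v _; rewrite ltnS !(tnth_nth x).
Qed.

Lemma pair_sum_cat G (s t : seq T) :
  pair_sum G (s ++ t) =
  pair_sum G s + pair_sum G t + \sum_(x <- s) \sum_(y <- t) G x y.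
Proof.
elim: s => [|x s IHs] /=; first by rewrite big_nil add0r addr0.
rewrite IHs big_cat big_cons /= -!addrA; congr (_ + _).
by rewrite addrCA; congr (_ + _); rewrite addrCA.
Qed.

Lemma pair_sum_blocks G (I : eqType) (B : I -> seq T) (t : V) (r : seq I) :
  uniq r -> (forall i, pair_sum G (B i) = 0) ->
  (forall i j, i != j -> \sum_(x <- B i) \sum_(y <- B j) G x y = t) ->
  pair_sum G (flatten [seq B i | i <- r]) = t *+ 'C(size r, 2).
Proof.
move=> + B0 Bt; elim: r => [|i r IHr] //= /andP[i_r r_uniq].
rewrite pair_sum_cat B0 add0r IHr // binS bin1 mulrnDr; congr (_ + _).
rewrite exchange_big /= big_flatten big_map /=.
rewrite (eq_big_seq (fun=> t)) => [|j j_r].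
  by rewrite big_const_seq count_predT iter_addr_0.
by rewrite exchange_big Bt //; apply: contraNneq i_r => ->.
Qed.

End PairSums.

Lemma pair_sum_eq0 (T : eqType) (V : nmodType) (G : T -> T -> V) (s : seq T) :
  uniq s -> (forall x y, x \in s -> y \in s -> x != y -> G x y = 0) ->
  pair_sum G s = 0.
Proof.
elim: s => //= x s IHs /andP[x_s s_uniq] G0; rewrite IHs // => [|y z ys zs].
  rewrite addr0 big_seq big1 // => y ys.
  apply: G0; first exact: mem_head; first by rewrite inE ys orbT.
  by apply: contraNneq x_s => ->.
by apply: G0; rewrite inE ?ys ?zs orbT.
Qed.

Lemma npairs_pair_sum (T : Type) (s : seq T) (P : T -> T -> bool)
    (Q : 'I_(size s) -> 'I_(size s) -> bool) :
  (forall u v : 'I_(size s), (u < v)%N ->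
     Q u v = P (tnth (in_tuple s) u) (tnth (in_tuple s) v)) ->
  npairs Q = pair_sum (fun x y => P x y : nat) s.
Proof.
move=> QP; rewrite /npairs card_set_sum -pair_sumE [RHS]big_mkcond.
by apply: eq_bigr => p _; case: ifP => // lt_p; rewrite QP.
Qed.

Lemma npairs0 m (P : 'I_m -> 'I_m -> bool) :
  npairs P = 0%N -> forall u v : 'I_m, (u < v)%N -> ~~ P u v.
Proof.
move=> /eqP; rewrite cards_eq0 => /eqP P0 u v uv.
by have := in_set0 (u, v); rewrite -P0 inE /= uv => /negbT.
Qed.

(** * Linear forms and normalized coefficient vectors *)

Section LinearForms.

Variables (F : finFieldType) (n : nat).
Implicit Types (c d x y : 'rV[F]_n) (a b t : F).
Local Notation q := #|F|.
Local Notation N := #|{: 'rV[F]_n}|.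

(** Linear forms on F^n are represented by their coefficient vectors d; [dot] is
    the evaluation, symmetric in its two arguments, and [lform] the resulting
    column. *)
Definition dot d x : F := \sum_i d 0 i * x 0 i.
Definition lform d : pfun F n := [ffun x => dot d x].
(** The last nonzero coefficient of d is 1. *)
Definition normalized d : bool := last_coef1 (fun i => d 0 i).
(** The last nonzero coefficient of c is 1 and has index l. *)
Definition is_last c (l : 'I_n) : bool :=
  (c 0 l == 1) && [forall j : 'I_n, (l < j)%N ==> (c 0 j == 0)].

Lemma dotC d x : dot d x = dot x d.
Proof. by apply: eq_bigr => i _; rewrite mulrC. Qed.

Lemma dotDr d x y : dot d (x + y) = dot d x + dot d y.
Proof. by rewrite -big_split; apply: eq_bigr => i _; rewrite mxE mulrDr. Qed.

Lemma dotZr d t x : dot d (t *: x) = t * dot d x.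
Proof. by rewrite mulr_sumr; apply: eq_bigr => i _; rewrite mxE mulrCA. Qed.

Lemma dotDl c d x : dot (c + d) x = dot c x + dot d x.
Proof. by rewrite dotC dotDr !(dotC x). Qed.

Lemma dotZl t d x : dot (t *: d) x = t * dot d x.
Proof. by rewrite dotC dotZr (dotC x). Qed.

Lemma dotNr d x : dot d (- x) = - dot d x.
Proof. by rewrite -scaleN1r dotZr mulN1r. Qed.

Lemma dot0r d : dot d 0 = 0.
Proof. by rewrite -(scale0r 0) dotZr mul0r. Qed.

Lemma dot_delta d i : dot d (delta_mx 0 i) = d 0 i.
Proof.
rewrite /dot (bigD1 i) //= mxE !eqxx mulr1 big1 ?addr0 // => j ne.
by rewrite mxE (negPf ne) andbF mulr0.
Qed.

Lemma dot_neq0 d : d != 0 -> exists i, d 0 i != 0.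
Proof.
by move=> d0; apply/existsP; apply: contraNT d0 => /existsPn d0;
   apply/eqP/rowP => i; rewrite mxE; apply/eqP; have := d0 i; rewrite negbK.
Qed.

(** A function that grows linearly with nonzero slope along the direction x0,
    on a set stable by translations along x0, takes each value equally often on
    this set.  All the counts of points below are instances of this. *)
Lemma card_slope (S : pred 'rV[F]_n) (G : 'rV[F]_n -> F) x0 w b :
  w != 0 -> (forall x t, S (x + t *: x0) = S x) ->
  (forall x t, S x -> G (x + t *: x0) = G x + t * w) ->
  (#|[set x | S x & G x == b]| * q = #|[set x | S x]|)%N.
Proof.
move=> w0 SS GG.
have le_fib u v : (#|[set x | S x & G x == u]| <= #|[set x | S x & G x == v]|)%N.
  pose f x := x + ((v - u) / w) *: x0.
  rewrite -(card_imset _ (@addIr _ (((v - u) / w) *: x0))).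
  apply/subset_leq_card/subsetP => _ /imsetP[x /[!inE] /andP[Sx /eqP Gx] ->].
  by rewrite SS Sx GG // Gx divfK // addrC subrK eqxx.
rewrite -[RHS]sum1_card (partition_big G xpredT) //=.
rewrite (eq_bigr (fun=> #|[set x | S x & G x == b]|)) => [|v _].
  by rewrite sum_nat_const mulnC.
rewrite sum1dep_card; apply/eqP; rewrite eqn_leq.
have -> : [set x | (x \in [set x0 | S x0]) && (G x == v)] = [set x | S x & G x == v].
  by apply/setP => x; rewrite !inE.
by rewrite !le_fib.
Qed.

Lemma is_last_uniq c l l' : is_last c l ->
  c 0 l' != 0 -> (forall j : 'I_n, (l' < j)%N -> c 0 j = 0) -> l' = l.
Proof.
case/andP => /eqP cl /forallP cj c0 cj'; apply: val_inj => /=.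
case: (ltngtP l' l) => // ll; first by rewrite cj' // in cl; case/eqP: (oner_neq0 F).
by have := cj l'; rewrite ll /= (negPf c0).
Qed.

Lemma is_lastP c l : is_last c l -> forall j : 'I_n, (l < j)%N -> c 0 j = 0.
Proof. by case/andP => _ /forallP H j lj; have := H j; rewrite lj => /eqP. Qed.

Lemma is_last1 c l : is_last c l -> c 0 l = 1.
Proof. by case/andP => /eqP. Qed.

Lemma normalizedP c : reflect (exists l, is_last c l) (normalized c).
Proof. exact: existsP. Qed.

Lemma normalized_neq0 c : normalized c -> c != 0.
Proof.
case/normalizedP => l /is_last1 cl; apply: contra_eqN cl => /eqP->.
by rewrite mxE eq_sym oner_eq0.
Qed.

Lemma normalize_scale c : c != 0 -> exists2 t, t != 0 & normalized (t *: c).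
Proof.
move=> /dot_neq0[i0 c0].
case: (@arg_maxnP _ i0 (fun i => c 0 i != 0) (fun i : 'I_n => val i) c0) => l cl lmax.
exists (c 0 l)^-1; first by rewrite invr_eq0.
apply/normalizedP; exists l; rewrite /is_last mxE mulVf // eqxx /=.
apply/forallP => j; apply/implyP => lj; rewrite mxE mulf_eq0 orbC.
by case: eqP => //= /eqP /lmax /=; rewrite leqNgt lj.
Qed.

Lemma normalized_scale_uniq c t : normalized c -> normalized (t *: c) -> t = 1.
Proof.
move=> /normalizedP[l cl] /normalizedP[l' cl'].
have t0 : t != 0.
  apply: contra_eq_neq (is_last1 cl') => ->.
  by rewrite mxE mul0r eq_sym oner_eq0.
suff E : l' = l by have := is_last1 cl'; rewrite mxE E (is_last1 cl) mulr1.
apply: (is_last_uniq cl) => [|j /(is_lastP cl')/eqP].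
  have /eqP := is_last1 cl'; rewrite mxE; apply: contraTneq => ->.
  by rewrite mulr0 eq_sym oner_eq0.
by rewrite mxE mulf_eq0 (negPf t0) => /eqP.
Qed.

(** Each punctured line contains exactly one normalized vector. *)
Lemma card_normalized (S : pred 'rV[F]_n) :
  (forall t d, t != 0 -> S (t *: d) = S d) -> ~~ S 0 ->
  (#|[set d | normalized d & S d]| * q.-1 = #|[set d | S d]|)%N.
Proof.
move=> SZ S0.
have -> : q.-1 = #|[set~ (0 : F)]| by rewrite cardsC1.
rewrite -cardsX -(card_in_imset (f := fun p => p.2 *: p.1)); last first.
  move=> [d t] [d' t']; rewrite !inE /= => /andP[/andP[nd _] t0] /andP[/andP[nd' _] t0'] E.
  have Ed : d' = (t'^-1 * t) *: d by rewrite -scalerA E scalerA mulVf // scale1r.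
  have E1 := nd'; rewrite Ed in E1; have E2 := normalized_scale_uniq nd E1.
  rewrite Ed E2 scale1r; congr (_, _).
  by rewrite -[RHS]mulr1 -E2 mulVKf.
apply: eq_card => d; rewrite [RHS]inE; apply/imsetP/idP => [[[d' t]]|Sd].
  by rewrite !inE /= => /andP[/andP[_ Sd'] t0] ->; rewrite SZ.
have d0 : d != 0 by apply: contraNneq S0 => <-.
have [t t0 nd] := normalize_scale d0.
exists (t *: d, t^-1) => /=; last by rewrite scalerA mulVf // scale1r.
by rewrite !inE nd SZ //= Sd invr_eq0.
Qed.

(** Distinct normalized vectors are linearly independent. *)
Lemma normalized_indep c c' : normalized c -> normalized c' -> c != c' ->
  exists e, dot c e = 1 /\ dot c' e = 0.
Proof.
move=> nc nc' ne; have /normalizedP[l cl] := nc.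
suff [j Hj] : exists j, c' 0 j - c 0 j * c' 0 l != 0.
  pose D := c' 0 j - c 0 j * c' 0 l.
  exists ((c' 0 j / D) *: delta_mx 0 l - (c' 0 l / D) *: delta_mx 0 j).
  rewrite !(dotDr, dotNr, dotZr, dot_delta) (is_last1 cl) mulr1.
  by split; rewrite /D; field.
apply/existsP; apply: contraNT ne => /existsPn H.
have [t E] : exists t, c' = t *: c.
  exists (c' 0 l); apply/rowP => j; rewrite mxE; have := H j.
  by rewrite negbK subr_eq0 mulrC => /eqP.
move: nc'; rewrite E => /(normalized_scale_uniq nc) E1.
by rewrite E1 scale1r.
Qed.

Lemma last_indep c l d : is_last c l -> d 0 l = 0 -> d != 0 ->
  exists e, dot c e = 0 /\ dot d e = 1.
Proof.
move=> cl dl /dot_neq0[i di].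
exists ((d 0 i)^-1 *: (delta_mx 0 i - c 0 i *: delta_mx 0 l)).
rewrite !(dotDr, dotNr, dotZr, dot_delta) dl (is_last1 cl) mulr1 subrr !mulr0.
by rewrite subr0 mulVf.
Qed.

End LinearForms.

(** * The sets Q_h *)

Section Blocks.

Variables (F : finFieldType) (n : nat).
Implicit Types (c d x y : 'rV[F]_n) (a b t : F) (l : 'I_n).
Local Notation q := #|F|.
Local Notation N := #|{: 'rV[F]_n}|.

(** The column h^2 + a h + g, where h and g are the linear forms c and d. *)
Definition quad c a d : pfun F n :=
  [ffun x => dot c x ^+ 2 + a * dot c x + dot d x].

(** The normalized linear forms in the variables other than X_l. *)
Definition dir_set l : {set 'rV[F]_n} := [set d | normalized d & d 0 l == 0].

(** The set Q_h for h the linear form c, whose last variable is X_l. *)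
Definition block c l : {set pfun F n} :=
  lform c |: [set quad c p.1 p.2 | p in setX [set: F] (dir_set l)].

Lemma Hset_coord : Hset (@X_ F n) = [set lform d | d in [pred d | normalized d]].
Proof.
apply/setP => f; apply/imsetP/imsetP => [[c cl ->]|[d dl ->]].
  exists (\row_j c j).
    move: cl; rewrite !inE /normalized /last_coef1 => /existsP[l Hl].
    apply/existsP; exists l; rewrite mxE; case/andP: Hl => -> /forallP H /=.
    by apply/forallP => j; rewrite mxE; apply: H.
  by apply/ffunP => x; rewrite !ffunE; apply: eq_bigr => i _; rewrite mxE ffunE.
exists [ffun j => d 0 j].
  move: dl; rewrite !inE /normalized /last_coef1 => /existsP[l Hl].
  apply/existsP; exists l; rewrite ffunE; case/andP: Hl => -> /forallP H /=.
  by apply/forallP => j; rewrite ffunE; apply: H.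
by apply/ffunP => x; rewrite !ffunE; apply: eq_bigr => i _; rewrite !ffunE.
Qed.

Lemma sum_lift l (G : 'I_n -> F) : G l = 0 ->
  \sum_i G i = \sum_(k < n.-1) G (lift l k).
Proof.
case: n l G => [[] //|m] l G G0.
by rewrite (bigD1_ord l) //= G0 add0r.
Qed.

Lemma ltn_lift l (i j : 'I_n.-1) : (lift l i < lift l j)%N = (i < j)%N.
Proof. by rewrite /= !ltnNge leq_bump2. Qed.

Lemma Hset_lift l :
  Hset (fun i : 'I_n.-1 => X_ F (lift l i)) = [set lform d | d in dir_set l].
Proof.
apply/setP => f; apply/imsetP/imsetP => [[c cl ->]|[d + ->]].
  pose d : 'rV[F]_n := \row_j (if unlift l j is Some k then c k else 0).
  have dE k : d 0 (lift l k) = c k by rewrite mxE liftK.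
  have dl : d 0 l = 0 by rewrite mxE unlift_none.
  exists d; last first.
    apply/ffunP => x; rewrite !ffunE /dot (@sum_lift l) ?dl ?mul0r //.
    by apply: eq_bigr => k _; rewrite dE ffunE.
  rewrite inE dl eqxx andbT; move: cl; rewrite inE => /existsP[k /andP[ck /forallP H]].
  apply/existsP; exists (lift l k); rewrite dE ck /=; apply/forallP => j.
  case: (unliftP l j) => [k' ->|->]; last by rewrite dl eqxx implybT.
  by rewrite dE ltn_lift; apply: H.
rewrite inE => /andP[/existsP[k /andP[dk /forallP H]] /eqP dl].
exists [ffun k => d 0 (lift l k)].
  rewrite inE; case: (unliftP l k) => [k' Ek|Ek]; last first.
    by move: dk; rewrite Ek dl eq_sym oner_eq0.
  apply/existsP; exists k'; rewrite ffunE -Ek dk /=; apply/forallP => j.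
  by rewrite ffunE -(ltn_lift l) -Ek; apply: H.
apply/ffunP => x; rewrite !ffunE /dot (@sum_lift l) ?dl ?mul0r //.
by apply: eq_bigr => k' _; rewrite !ffunE.
Qed.

Lemma Qh_block c l : is_last c l -> Qh (lform c) = block c l.
Proof.
move=> cl; rewrite /Qh; case: pickP => [l' /andP[]|/(_ l)]; last first.
  rewrite /= /last_index /Defs.coefX ffunE dot_delta (is_last1 cl) oner_eq0 /=.
  move/negbT/forallPn => [j]; rewrite ffunE dot_delta negb_imply => /andP[lj].
  by rewrite (is_lastP cl lj) eqxx.
rewrite /Defs.coefX ffunE dot_delta => cl' /forallP cj.
have -> : l' = l.
  apply: (is_last_uniq cl) => // j lj; apply/eqP.
  by have := cj j; rewrite lj ffunE dot_delta.
rewrite /Q1 Hset_lift; congr (_ |: _); apply/setP => f.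
apply/imset2P/imsetP => [[a _ _ /imsetP[d dl ->] ->]|[[a d] /setXP[_ dl] ->]].
  exists (a, d); first by rewrite in_setX in_setT.
  by apply/ffunP => x; rewrite !ffunE.
exists a (lform d); rewrite ?inE ?imset_f //.
by apply/ffunP => x; rewrite !ffunE.
Qed.

Lemma dir_setP l d : d \in dir_set l -> [/\ normalized d, d 0 l = 0 & d != 0].
Proof. by rewrite inE => /andP[nd /eqP]; split=> //; apply: normalized_neq0. Qed.

Section OneBlock.

Variables (c : 'rV[F]_n) (l : 'I_n).
Hypothesis cl : is_last c l.

Lemma quad_inj : {in setX [set: F] (dir_set l) &, injective (fun p => quad c p.1 p.2)}.
Proof.
move=> [a d] [a' d'] /setXP[_ /dir_setP[_ dl _]] /setXP[_ /dir_setP[_ dl' _]] /= E.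
have E1 x : (a - a') * dot c x + dot (d - d') x = 0.
  have := congr1 (fun f : pfun F n => f x) E; rewrite !ffunE => /eqP.
  rewrite -subr_eq0 => /eqP E1; rewrite -[RHS]E1 dotDl -scaleN1r dotZl; ring.
have Ea : a = a'.
  have := E1 (delta_mx 0 l); rewrite !dot_delta !mxE dl dl' (is_last1 cl).
  by rewrite subr0 addr0 mulr1 => /eqP; rewrite subr_eq0 => /eqP.
rewrite Ea; congr (_, _); apply/rowP => i.
have := E1 (delta_mx 0 i); rewrite Ea subrr mul0r add0r dot_delta !mxE => /eqP.
by rewrite subr_eq0 => /eqP.
Qed.

Lemma lform_notin_quad :
  lform c \notin [set quad c p.1 p.2 | p in setX [set: F] (dir_set l)].
Proof.
apply/imsetP => -[[a d] /setXP[_ /dir_setP[_ dl d0]] /= E].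
have [e [ce de]] := last_indep cl dl d0.
have := congr1 (fun f : pfun F n => f e) E; rewrite !ffunE ce de => /eqP.
by rewrite expr0n mulr0 !add0r eq_sym oner_eq0.
Qed.

Lemma block_ind (P : pfun F n -> Prop) :
  P (lform c) -> (forall a d, d \in dir_set l -> P (quad c a d)) ->
  forall f, f \in block c l -> P f.
Proof.
move=> P1 P2 f; rewrite in_setU1 => /orP[/eqP->//|/imsetP[[a d] /setXP[_ dl] ->]].
exact: P2.
Qed.

Lemma quad_in_block a d : d \in dir_set l -> quad c a d \in block c l.
Proof.
move=> dl; apply/setU1P; right; apply/imsetP; exists (a, d) => //.
by rewrite in_setX in_setT.
Qed.

Lemma sum_block (V : nmodType) (G : pfun F n -> V) :
  \sum_(f in block c l) G f =
  G (lform c) + \sum_a \sum_(d in dir_set l) G (quad c a d).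
Proof.
rewrite big_setU1 ?lform_notin_quad //; congr (_ + _).
rewrite big_imset /=; last exact: quad_inj.
rewrite pair_big_dep /=; apply: eq_bigl => -[a d] /=.
by rewrite inE /= inE.
Qed.

Lemma card_coord0 : (#|[set d : 'rV[F]_n | (d 0 l == 0)%R]| * q = N)%N.
Proof.
have -> : [set d : 'rV[F]_n | d 0 l == 0] = [set d | xpredT d & dot (delta_mx 0 l) d == 0].
  by apply/setP => d; rewrite !inE dotC dot_delta.
rewrite (@card_slope _ _ _ _ (delta_mx 0 l) 1) ?oner_eq0 //.
  by apply: eq_card => d; rewrite !inE.
by move=> x t _; rewrite dotDr dotZr dot_delta mxE !eqxx.
Qed.

Lemma card_dir_set : ((#|dir_set l| * q.-1).+1 * q = N)%N.
Proof.
rewrite -card_coord0; congr (_ * _)%N.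
have -> : dir_set l = [set d | normalized d & (d 0 l == 0) && (d != 0)].
  apply/setP => d; rewrite !inE; case nd: (normalized d) => //=.
  by rewrite (normalized_neq0 nd) andbT.
rewrite card_normalized => [|t d t0|]; last by rewrite eqxx andbF.
  rewrite [RHS](cardsD1 0) inE mxE eqxx add1n; congr (_.+1).
  by apply: eq_card => d; rewrite !inE andbC.
by rewrite mxE mulf_eq0 scaler_eq0 (negPf t0).
Qed.

Lemma card_block : (#|block c l| * q.-1 = N.-1)%N.
Proof.
rewrite cardsU1 lform_notin_quad card_in_imset; last exact: quad_inj.
rewrite cardsX (_ : #|[set: F]| = q) ?cardsT // -card_dir_set.
have [p Ep] : exists p, q = p.+1 by exists q.-1; rewrite prednK // (cardD1 0) inE.
rewrite !Ep; have ar D : ((1 + p.+1 * D) * p = ((D * p).+1 * p.+1).-1)%N by nia.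
exact: ar.
Qed.

(** Two distinct rows agree in exactly (q^(n-1) - 1) / (q - 1) columns of Q_h. *)
Lemma block_coincidence x y : x != y ->
  ((#|[set f in block c l | f x == f y]| * q.-1).+1 * q = N)%N.
Proof.
move=> ne; pose v := x - y.
have v0 : v != 0 by rewrite subr_eq0.
have cardE : #|[set f in block c l | f x == f y]| =
    ((dot c x == dot c y) + \sum_a \sum_(d in dir_set l)
      (quad c a d x == quad c a d y))%N.
  rewrite -sum1dep_card big_mkcondr /= (sum_block (fun f => if f x == f y then 1 else 0)%N).
  by rewrite !ffunE.
have quadE a d : (quad c a d x == quad c a d y) =
    ((dot c x + dot c y + a) * dot c v + dot d v == 0).
  by rewrite !ffunE -subr_eq0 !dotDr !dotNr; congr (_ == 0); ring.
have cvE : (dot c x == dot c y) = (dot c v == 0).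
  by rewrite dotDr dotNr subr_eq0.
clearbody v; rewrite cardE cvE; have [cv0|cv0] := eqVneq (dot c v) 0.

  rewrite (eq_bigr (fun=> #|[set d in dir_set l | dot d v == 0]|)); last first.
    move=> a _; rewrite -sum1dep_card big_mkcondr /=; apply: eq_bigr => d _.
    by rewrite quadE cv0 mulr0 add0r.
  rewrite sum_nat_const.
  pose S := [pred d : 'rV[F]_n | (d 0 l == 0) && (dot d v == 0) && (d != 0)].
  have -> : [set d in dir_set l | dot d v == 0] = [set d | normalized d & S d].
    apply/setP => d; rewrite !inE; case nd: (normalized d) => //=.
    by rewrite (normalized_neq0 nd) andbT.
  have /existsP[j /andP[jl vj]] : [exists j, (j != l) && (v 0 j != 0)].
    apply: contraNT v0 => /existsPn H.
    have vE : v = v 0 l *: delta_mx 0 l.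
      apply/rowP => j; rewrite !mxE /=; have := H j.
      by case: eqVneq => [->|] /=; rewrite ?mulr1 // mulr0 negbK => _ /eqP.
    by move: cv0; rewrite vE dotZr dot_delta (is_last1 cl) mulr1 => ->; rewrite scale0r.
  have cS : ((#|[set d | normalized d & S d]| * q.-1).+1 * q * q = N)%N.
    rewrite card_normalized => [|t d t0|]; last by rewrite /= eqxx andbF.
      rewrite -card_coord0; congr (_ * _)%N.
      have <- : (#|[set d : 'rV[F]_n | (d 0%R l == 0%R) & (dot v d == 0%R)]| * q =
                 #|[set d : 'rV[F]_n | (d 0%R l == 0%R)]|)%N.
        apply: (card_slope (x0 := delta_mx 0 j) _ vj) => [d t|d t _].
          by rewrite !mxE eqxx (eq_sym l) (negPf jl) mulr0 addr0.
        by rewrite dotDr dotZr dot_delta.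
      congr (_ * _)%N; rewrite [RHS](cardsD1 0) !inE mxE dot0r eqxx add1n.
      by congr (_.+1); apply: eq_card => d; rewrite !inE dotC andbC.
    by rewrite /= mxE dotZl !mulf_eq0 scaler_eq0 (negPf t0).
  rewrite -cS; have q0 : (0 < q)%N by rewrite (cardD1 0) inE.
  have ar D p : (0 < p)%N ->
      (((1 + p * D) * p.-1).+1 * p = (D * p.-1).+1 * p * p)%N.
    by case: p => // p _ /=; nia.
  exact: ar.

rewrite exchange_big -card_dir_set /= add0n; congr ((_ * _).+1 * _)%N.
rewrite -sum1_card; apply: eq_bigr => d _.
rewrite (bigD1 (- (dot d v) / dot c v - dot c x - dot c y)) //=.
rewrite big1 ?addn0 => [|a ne_a].
  rewrite quadE (_ : _ * _ + _ = 0) ?eqxx //; field; exact: cv0.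
rewrite quadE; case: eqP => // E; case/eqP: ne_a.
apply/eqP; rewrite -subr_eq0 -(mulIr_eq0 _ (mulIf cv0)) -[X in _ == X]E -subr_eq0.
by apply/eqP; field.
Qed.

End OneBlock.

End Blocks.

(** * The projected value of two functions *)

Section FunctionA2.

Variables (F : finFieldType) (n : nat) (C : numClosedFieldType).
Implicit Types (c d x y : 'rV[F]_n) (a b t : F) (l : 'I_n) (f g : pfun F n).
Local Notation V := 'rV[F]_n.
Local Notation q := #|F|.
Local Notation N := #|{: 'rV[F]_n}|.
Local Notation qC := (#|F|%:R : C).
Local Notation NC := (#|{: 'rV[F]_n}|%:R : C).

(** The number of points with level combination (b, b'). *)
Definition level_card f g b b' : nat := #|[set x : V | f x == b & g x == b']|.

(** The number of ordered pairs of points at which both f and g agree. *)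
Definition pair_coincidence f g : nat :=
  #|[set p : V * V | (f p.1 == f p.2) && (g p.1 == g p.2)]|.

(** The projected A_2 value of the pair of columns f, g, when these are balanced. *)
Definition function_A2 f g : C := qC ^+ 2 * (pair_coincidence f g)%:R / NC ^+ 2 - 1.

Local Notation fA2 := function_A2.

(** Balance of a single column; divisions are avoided. *)
Definition fbalanced f : Prop := forall b, (#|[set x : V | f x == b]| * q = N)%N.

Lemma q_gt0 : (0 < q)%N. Proof. by rewrite (cardD1 0) inE. Qed.
Lemma N_gt0 : (0 < N)%N. Proof. by rewrite (cardD1 0) inE. Qed.
Lemma qC_neq0 : qC != 0. Proof. by rewrite pnatr_eq0 -lt0n q_gt0. Qed.
Lemma NC_neq0 : NC != 0. Proof. by rewrite pnatr_eq0 -lt0n N_gt0. Qed.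

Lemma fA2C f g : fA2 f g = fA2 g f.
Proof.
rewrite /function_A2 /pair_coincidence; congr (_ * _%:R / _ - _).
by apply: eq_card => p; rewrite !inE andbC.
Qed.

Lemma pair_coincidence_level f g :
  pair_coincidence f g = (\sum_b \sum_b' level_card f g b b' ^ 2)%N.
Proof.
rewrite /pair_coincidence card_set_sum.
rewrite -(pair_bigA _ (fun x y => ((f x == f y) && (g x == g y) : nat))) /=.
rewrite (partition_big f xpredT) //=; apply: eq_bigr => b _.
rewrite (partition_big g xpredT) //=; apply: eq_bigr => b' _.
rewrite (eq_bigr (fun=> level_card f g b b')) => [|x /andP[/eqP fx /eqP gx]].
  by rewrite sum_nat_const /level_card cardsE.
rewrite -card_set_sum; apply: eq_card => y.
by rewrite !inE fx gx ![_ == f y]eq_sym ![_ == g y]eq_sym.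
Qed.

Lemma orthogonal_fA2 f g :
  (forall b b', level_card f g b b' * q * q = N)%N -> fA2 f g = 0.
Proof.
move=> lev; rewrite /function_A2 pair_coincidence_level.
have levC b b' : (level_card f g b b')%:R = NC / qC ^+ 2.
  by rewrite -(lev b b') !natrM; field; rewrite qC_neq0.
rewrite natr_sum (eq_bigr (fun=> qC * (NC / qC ^+ 2) ^+ 2)) => [|b _].
  by rewrite sumr_const -[_ *+ _]mulr_natr; field; rewrite qC_neq0 NC_neq0.
rewrite natr_sum (eq_bigr (fun=> (NC / qC ^+ 2) ^+ 2)) => [|b' _].
  by rewrite sumr_const -[_ *+ _]mulr_natr mulrC.
by rewrite natrX levC.
Qed.

Lemma fbalanced_slope f x0 w : w != 0 ->
  (forall x t, f (x + t *: x0) = f x + t * w) -> fbalanced f.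
Proof.
move=> w0 fw b; have := @card_slope F n predT f x0 w b w0 (fun _ _ => erefl).
move=> /(_ (fun x t _ => fw x t)) E.
transitivity #|[set x : V | predT x]|; last by apply: eq_card => x; rewrite inE.
by rewrite -E; congr (_ * _)%N; apply: eq_card => x; rewrite !inE.
Qed.

(** If f is constant along x0 and g grows linearly along x0, then the columns
    f and g are orthogonal. *)
Lemma fA2_slope f g x0 w : fbalanced f -> w != 0 ->
  (forall x t, f (x + t *: x0) = f x) ->
  (forall x t, g (x + t *: x0) = g x + t * w) -> fA2 f g = 0.
Proof.
move=> balf w0 fw gw; apply: orthogonal_fA2 => b b'; rewrite -(balf b).
congr (_ * _)%N; apply: (card_slope (x0 := x0) _ w0) => [x t|x t _]; last exact: gw.
by rewrite fw.
Qed.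

Lemma lform_shift c x0 x t : lform c (x + t *: x0) = lform c x + t * dot c x0.
Proof. by rewrite !ffunE dotDr dotZr. Qed.

Lemma quad_shift c a d x0 x t : dot c x0 = 0 ->
  quad c a d (x + t *: x0) = quad c a d x + t * dot d x0.
Proof. by move=> c0; rewrite !ffunE !dotDr !dotZr c0; ring. Qed.

Section OneBlock.

Variables (c : 'rV[F]_n) (l : 'I_n).
Hypothesis cl : is_last c l.

Lemma lform_balanced : fbalanced (lform c).
Proof.
apply: (fbalanced_slope (x0 := delta_mx 0 l) (oner_neq0 F)) => x t.
by rewrite lform_shift dot_delta (is_last1 cl).
Qed.

Lemma block_balanced f : f \in block c l -> fbalanced f.
Proof.
move: f; apply: block_ind => [|a d /dir_setP[_ dl d0]]; first exact: lform_balanced.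
have [e [ce de]] := last_indep cl dl d0.
apply: (fbalanced_slope (x0 := e) (oner_neq0 F)) => x t.
by rewrite quad_shift // de.
Qed.

Lemma fA2_lform_quad a d : d \in dir_set F l -> fA2 (lform c) (quad c a d) = 0.
Proof.
move=> /dir_setP[_ dl d0]; have [e [ce de]] := last_indep cl dl d0.
apply: (fA2_slope (x0 := e) lform_balanced (oner_neq0 F)) => x t.
  by rewrite lform_shift ce mulr0 addr0.
by rewrite quad_shift // de.
Qed.

Lemma fA2_block f g : f \in block c l -> g \in block c l -> f != g -> fA2 f g = 0.
Proof.
move=> fB gB; move: f fB; apply: block_ind => [|a d dl].
  move: g gB; apply: block_ind => [|a d dl _]; first by rewrite eqxx.
  exact: fA2_lform_quad.
move: g gB; apply: block_ind => [_|a' d' dl'].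
  by rewrite fA2C fA2_lform_quad.
move=> ne; have [Ed|ne_d] := eqVneq d d'.
  subst d'; rewrite -[RHS](fA2_lform_quad a dl) /function_A2 /pair_coincidence.
  have ne_a : a - a' != 0 by rewrite subr_eq0; apply: contraNneq ne => ->.
  congr (_ * _%:R / _ - _); apply: eq_card => -[x y]; rewrite !inE !ffunE /=.
  apply/andP/andP => -[/eqP E1 /eqP E2]; split; apply/eqP => //.
    apply: (mulfI ne_a); apply/eqP; rewrite -subr_eq0.
    have /eqP := congr2 (fun u v => u - v) E1 E2; rewrite -subr_eq0.
    by congr (_ == 0); ring.
  by move: E2; rewrite E1 => /addrI->.
have [_ _ d0] := dir_setP dl; have [_ dl0 _] := dir_setP dl.
have [nd' dl0' _] := dir_setP dl'; have [nd _ _] := dir_setP dl.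
have [e [de' de]] : exists e, dot d' e = 1 /\ dot d e = 0.
  by apply: normalized_indep; rewrite // eq_sym.
(* Correcting e along the last variable of c does not affect d and d'. *)
pose k := e - dot c e *: delta_mx 0 l.
have [ck dk dk'] : [/\ dot c k = 0, dot d k = 0 & dot d' k = 1].
  rewrite !dotDr !dotNr !dotZr !dot_delta (is_last1 cl) dl0 dl0' de de'.
  by split; ring.
apply: (fA2_slope (x0 := k) (w := 1)); rewrite ?oner_neq0 //.
- exact/block_balanced/quad_in_block.
- by move=> x t; rewrite quad_shift // dk mulr0 addr0.
- by move=> x t; rewrite quad_shift // dk'.
Qed.

End OneBlock.
End FunctionA2.

(** * Two distinct sets Q_h *)

Section TwoBlocks.

Variables (F : finFieldType) (n : nat) (C : numClosedFieldType).
Implicit Types (d x y : 'rV[F]_n) (a b t : F).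
Local Notation V := 'rV[F]_n.
Local Notation q := #|F|.
Local Notation N := #|{: 'rV[F]_n}|.
Local Notation qC := (#|F|%:R : C).
Local Notation NC := (#|{: 'rV[F]_n}|%:R : C).
Local Notation fA2 := (function_A2 C).

(** The form d vanishes on the common kernel of the forms c and c', that is, d is
    a linear combination of them. *)
Definition vanishes c c' d : bool :=
  [forall x : V, (dot c x == 0) && (dot c' x == 0) ==> (dot d x == 0)].

Lemma vanishesP c c' d :
  reflect (forall x, dot c x = 0 -> dot c' x = 0 -> dot d x = 0) (vanishes c c' d).
Proof.
apply: (iffP forallP) => H x; last by apply/implyP => /andP[/eqP cx /eqP cx']; rewrite H.
by move=> cx cx'; have := H x; rewrite cx cx' eqxx => /eqP.
Qed.

Lemma vanishesPn c c' d :
  ~~ vanishes c c' d -> exists x, [/\ dot c x = 0, dot c' x = 0 & dot d x != 0].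
Proof.
move=> /forallPn[x]; rewrite negb_imply => /andP[/andP[/eqP ? /eqP ?] ?].
by exists x.
Qed.

Lemma vanishesC c c' d : vanishes c c' d = vanishes c' c d.
Proof. by apply: eq_forallb => x; rewrite andbC. Qed.

Variables (c c' : 'rV[F]_n) (l l' : 'I_n).
Hypothesis cl : is_last c l.
Hypothesis cl' : is_last c' l'.
Hypothesis ne_c : c != c'.

Local Notation van := (vanishes c c').

Lemma dual_vectors : exists e e', [/\ dot c e = 1, dot c' e = 0, dot c e' = 0 & dot c' e' = 1].
Proof.
have nc : normalized c by apply/normalizedP; exists l.
have nc' : normalized c' by apply/normalizedP; exists l'.
have [e [? ?]] := normalized_indep nc nc' ne_c.
have [|e' [? ?]] := normalized_indep nc' nc; first by rewrite eq_sym.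
by exists e, e'.
Qed.

Lemma vanishes_span d e e' : [/\ dot c e = 1, dot c' e = 0, dot c e' = 0 & dot c' e' = 1] ->
  van d -> d = dot d e *: c + dot d e' *: c'.
Proof.
case=> ce ce' c'e c'e' /vanishesP vd; apply/rowP => i; rewrite !mxE.
have := vd (delta_mx 0 i - c 0 i *: e - c' 0 i *: e').
rewrite !(dotDr, dotNr, dotZr, dot_delta) ce ce' c'e c'e' => H.
have {H}/eqP := H ltac:(ring) ltac:(ring); rewrite !subr_eq add0r => /eqP->.
by ring.
Qed.

Lemma vanishes_lin a b : van (a *: c + b *: c').
Proof. by apply/vanishesP => x cx cx'; rewrite dotDl !dotZl cx cx' !mulr0 addr0. Qed.

(** The combination of c and c' that does not involve X_l; it spans the
    combinations with this property. *)
Definition trace_dir := c' - c' 0 l *: c.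

Lemma dir_vanishes d : d \in dir_set F l -> van d -> exists2 t, t != 0 & d = t *: trace_dir.
Proof.
move=> /dir_setP[_ dl d0] vd; have [e [e' E]] := dual_vectors.
have Ed := vanishes_span E vd; set al := dot d e in Ed; set be := dot d e' in Ed.
have Eal : al = - be * c' 0 l.
  have : d 0 l = al + be * c' 0 l by rewrite Ed !mxE (is_last1 cl) mulr1.
  by rewrite dl => /esym/eqP; rewrite addr_eq0 => /eqP->; rewrite mulNr.
have Ed' : d = be *: trace_dir.
  rewrite Ed Eal /trace_dir scalerBr scalerA mulNr scaleNr addrC; congr (_ - _).
exists be => //; apply: contraNneq d0 => be0.
by rewrite Ed' be0 scale0r.
Qed.

(** Among the forms g allowed in Q_h exactly one is a combination of h and h'. *)
Lemma unique_vanishing_dir : exists d0, forall d, (d \in dir_set F l) && van d = (d == d0).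
Proof.
have t0 : trace_dir != 0.
  have [e [e' [_ _ ce' ce'']]] := dual_vectors.
  apply/eqP => /(congr1 (fun d : V => dot d e')); rewrite dotDl -scaleNr dotZl ce' ce''.
  by rewrite dotC dot0r mulr0 addr0 => /eqP; rewrite oner_eq0.
have tl : trace_dir 0 l = 0 by rewrite !mxE (is_last1 cl) mulr1 subrr.
have [t tn0 nt] := normalize_scale t0.
exists (t *: trace_dir) => d; apply/andP/eqP => [[dl vd]|->]; last first.
  rewrite inE nt mxE tl mulr0 eqxx; split=> //.
  rewrite /trace_dir scalerBr scalerA addrC -scaleNr; exact: vanishes_lin.
have [u u0 Ed] := dir_vanishes dl vd.
have [nd _ _] := dir_setP dl.
have E : d = (u / t) *: (t *: trace_dir) by rewrite scalerA divfK.
move: (nd); rewrite E => /(normalized_scale_uniq nt) ->.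
by rewrite scale1r.
Qed.

Lemma card_vanishing_dir : #|[set d in dir_set F l | van d]| = 1%N.
Proof.
have [d0 H] := unique_vanishing_dir.
by apply/eqP/cards1P; exists d0; apply/setP => d; rewrite !inE -H inE.
Qed.

Lemma fA2_lforms : fA2 (lform c) (lform c') = 0.
Proof.
have [e [e' [_ _ ce' ce'']]] := dual_vectors.
apply: (fA2_slope _ (x0 := e') (lform_balanced cl) (oner_neq0 F)) => x t.
  by rewrite lform_shift ce' mulr0 addr0.
by rewrite lform_shift ce''.
Qed.

Lemma fA2_lform_quad_novanish a d : ~~ van d -> fA2 (lform c) (quad c' a d) = 0.
Proof.
move=> /vanishesPn[k [ck ck' dk]].
apply: (fA2_slope _ (x0 := k) (lform_balanced cl) dk) => x t.
  by rewrite lform_shift ck mulr0 addr0.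
by rewrite quad_shift.
Qed.

Lemma fA2_quad_slope a d a' d' k : d \in dir_set F l ->
  dot c k = 0 -> dot c' k = 0 -> dot d k = 0 -> dot d' k != 0 ->
  fA2 (quad c a d) (quad c' a' d') = 0.
Proof.
move=> dl ck ck' dk dk'.
apply: (fA2_slope _ (x0 := k) (block_balanced cl (quad_in_block c a dl)) dk') => x t.
  by rewrite quad_shift // dk mulr0 addr0.
by rewrite quad_shift.
Qed.

End TwoBlocks.

(** * Odd order: values for two quadratic columns *)

Lemma odd_card_two_neq0 (F : finFieldType) : odd #|F| -> (2%:R : F) != 0.
Proof.
move=> oddF; apply: contraL oddF => two0.
have char2 : 2%N \in [pchar F] by rewrite inE /= two0.
rewrite (card_pprimeChar char2) oddX orbF -lt0n.
rewrite lt0n; apply/eqP => E; have := card_pprimeChar char2; rewrite E => E1.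
by have := finNzRing_gt1 F; rewrite E1.
Qed.

Lemma even_card_pchar2 (F : finFieldType) : ~~ odd #|F| ->
  2%N \in [pchar F] /\ exists m, #|F| = (2 ^ m)%N.
Proof.
have [p p_pr charp] := finPcharP F => evF.
have Eq := card_pprimeChar charp.
have p2 : p = 2%N.
  move: evF; rewrite Eq oddX negb_or => /andP[_].
  by case: (even_prime p_pr) => // ->.
by subst p; split=> //; eexists; exact: Eq.
Qed.

(** Pairs of points sorted by their difference v. *)
Lemma pair_coincidence_diff (F : finFieldType) n (f g : pfun F n) :
  pair_coincidence f g =
  (\sum_v #|[set y | (f (y + v)%R == f y) && (g (y + v)%R == g y)]|)%N.
Proof.
rewrite /pair_coincidence card_set_sum.
rewrite -(pair_bigA _ (fun x y => ((f x == f y) && (g x == g y) : nat))) /=.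
rewrite exchange_big /=; under [RHS]eq_bigr do rewrite card_set_sum.
rewrite [RHS]exchange_big /=; apply: eq_bigr => y _.
by rewrite (reindex_inj (addrI y)).
Qed.

Section OddCount.

Variables (F : finFieldType) (n : nat) (C : numClosedFieldType).
Implicit Types (d x y v : 'rV[F]_n) (a b t : F).
Local Notation V := 'rV[F]_n.
Local Notation q := #|F|.
Local Notation N := #|{: 'rV[F]_n}|.
Local Notation qC := (#|F|%:R : C).
Local Notation NC := (#|{: 'rV[F]_n}|%:R : C).
Local Notation fA2 := (function_A2 C).

(** The number of points satisfying P, as an element of C, so that it can be
    added, subtracted and divided freely. *)
Definition ccount (P : pred V) : C := \sum_v (P v)%:R.

Lemma ccountE P : ccount P = #|[set v | P v]|%:R.
Proof. by rewrite card_set_sum natr_sum. Qed.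

Lemma ccount_const (b : bool) : ccount (fun=> b) = NC * b%:R.
Proof. by rewrite /ccount sumr_const mulr_natl. Qed.

Lemma ccount_all : ccount predT = NC.
Proof. by rewrite (ccount_const true) mulr1. Qed.

Lemma eq_ccount (P Q : pred V) : P =1 Q -> ccount P = ccount Q.
Proof. by move=> E; apply: eq_bigr => v _; rewrite E. Qed.

Lemma ccount_slope (P : pred V) (G : V -> F) x0 w b :
  w != 0 -> (forall x t, P (x + t *: x0) = P x) ->
  (forall x t, P x -> G (x + t *: x0) = G x + t * w) ->
  ccount (fun v => P v && (G v == b)) = ccount P / qC.
Proof.
move=> w0 PP GG; rewrite !ccountE -(card_slope b w0 PP GG) natrM mulfK //.
exact: qC_neq0.
Qed.

Hypothesis oddq : odd q.
Variables (c c' : V) (l l' : 'I_n).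
Hypothesis cl : is_last c l.
Hypothesis cl' : is_last c' l'.
Hypothesis ne_c : c != c'.

Local Notation van := (vanishes c c').

Lemma lform_diff d v y : (lform d (y + v) == lform d y) = (dot d v == 0).
Proof. by rewrite !ffunE -subr_eq0 dotDr addrC addKr. Qed.

Lemma quad_diff u a d v y : (quad u a d (y + v) == quad u a d y) =
  (dot u v * (2 * dot u y + dot u v + a) + dot d v == 0).
Proof. by rewrite !ffunE -subr_eq0 !dotDr; congr (_ == 0); ring. Qed.

Lemma two0 : (2 : F) != 0. Proof. exact: odd_card_two_neq0. Qed.

(** Number of y with f(y + v) = f(y) and f'(y + v) = f'(y), for f = h and
    f' = h'^2 + a h' + g; the truth values on the right depend on v alone. *)
Lemma ccount_lform_quad a d v :
  ccount (fun y => (lform c (y + v) == lform c y)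
               && (quad c' a d (y + v) == quad c' a d y)) =
  NC / qC * ((dot c v == 0)%:R - ((dot c v == 0) && (dot c' v == 0))%:R)
  + NC * ((dot c v == 0) && (dot c' v == 0) && (dot d v == 0))%:R.
Proof.
rewrite (eq_ccount (fun y => congr2 andb (lform_diff c v y) (quad_diff c' a d v y))).
have [cv|cv] := eqVneq (dot c v) 0; last first.
  by rewrite (ccount_const false) /= !subrr !mulr0 addr0.
have [e [e' [_ _ _ ce']]] := dual_vectors cl cl' ne_c.
have [c'v|c'v] := eqVneq (dot c' v) 0.
  rewrite (eq_ccount (Q := fun=> dot d v == 0)) => [|y]; last by rewrite /= c'v mul0r add0r.
  by rewrite ccount_const /= subrr mulr0 add0r.
rewrite /= subr0 mulr1 mulr0 addr0 -ccount_all.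
rewrite -(@ccount_slope predT (fun y => dot c' v * (2 * dot c' y + dot c' v + a) + dot d v)
   e' (dot c' v * 2) 0) //; first by apply: mulf_neq0 => //; exact: two0.
by move=> x t _; rewrite dotDr dotZr ce'; ring.
Qed.

(** The same for f = h^2 + a h + g and f' = h'^2 + a' h' + g'.  The equation for
    f is affine in h(y) with slope 2 h(v), and this is where odd order is used. *)
Lemma ccount_quad_quad a d a' d' v :
  ccount (fun y => (quad c a d (y + v) == quad c a d y)
               && (quad c' a' d' (y + v) == quad c' a' d' y)) =
  NC / qC ^+ 2 * (1 - (dot c v == 0)%:R - (dot c' v == 0)%:R
                    + ((dot c v == 0) && (dot c' v == 0))%:R)
  + NC / qC * (((dot c' v == 0) && (dot d' v == 0))%:R
               - ((dot c v == 0) && (dot c' v == 0) && (dot d' v == 0))%:R)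
  + NC / qC * (((dot c v == 0) && (dot d v == 0))%:R
               - ((dot c v == 0) && (dot c' v == 0) && (dot d v == 0))%:R)
  + NC * ((dot c v == 0) && (dot c' v == 0) && (dot d v == 0) && (dot d' v == 0))%:R.
Proof.
rewrite (eq_ccount (fun y => congr2 andb (quad_diff c a d v y) (quad_diff c' a' d' v y))).
have [e [e' [ce ce' c'e c'e']]] := dual_vectors cl cl' ne_c.
have slope1 : dot c v != 0 -> ccount (fun y =>
    dot c v * (2 * dot c y + dot c v + a) + dot d v == 0) = NC / qC.
  move=> cv; rewrite -ccount_all.
  rewrite -(@ccount_slope predT (fun y => dot c v * (2 * dot c y + dot c v + a) + dot d v)
    e (dot c v * 2) 0) //; first by apply: mulf_neq0 => //; exact: two0.
  by move=> x t _; rewrite dotDr dotZr ce; ring.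
have slope2 : dot c' v != 0 -> ccount (fun y =>
    dot c' v * (2 * dot c' y + dot c' v + a') + dot d' v == 0) = NC / qC.
  move=> cv; rewrite -ccount_all.
  rewrite -(@ccount_slope predT (fun y => dot c' v * (2 * dot c' y + dot c' v + a') + dot d' v)
    e' (dot c' v * 2) 0) //; first by apply: mulf_neq0 => //; exact: two0.
  by move=> x t _; rewrite dotDr dotZr c'e'; ring.
have [cv|cv] := eqVneq (dot c v) 0; have [c'v|c'v] := eqVneq (dot c' v) 0.
- rewrite (eq_ccount (Q := fun=> (dot d v == 0) && (dot d' v == 0))) => [|y].
    by rewrite ccount_const; case: (_ == 0); case: (_ == 0) => /=; ring.
  by rewrite /= cv c'v !mul0r !add0r.
- rewrite (eq_ccount (Q := fun y => (dot d v == 0)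
     && (dot c' v * (2 * dot c' y + dot c' v + a') + dot d' v == 0))) => [|y].
    case: (dot d v == 0) => /=; first by rewrite slope2 //; ring.
    by rewrite (ccount_const false) /=; ring.
  by rewrite /= cv mul0r add0r.
- rewrite (eq_ccount (Q := fun y => (dot d' v == 0)
     && (dot c v * (2 * dot c y + dot c v + a) + dot d v == 0))) => [|y].
    case: (dot d' v == 0) => /=; first by rewrite slope1 //; ring.
    by rewrite (ccount_const false) /=; ring.
  by rewrite /= c'v mul0r add0r andbC.
rewrite (@ccount_slope _ (fun y => dot c' v * (2 * dot c' y + dot c' v + a') + dot d' v)
    e' (dot c' v * 2) 0).
- by rewrite slope1 //=; field; exact: qC_neq0.
- by apply: mulf_neq0 => //; exact: two0.
- by move=> x t; rewrite !dotDr !dotZr c'e mulr0 addr0.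
- by move=> x t _; rewrite dotDr dotZr c'e'; ring.
Qed.

Lemma sum_ccount (P : V -> pred V) :
  (\sum_v #|[set y | P v y]|)%:R = \sum_v ccount (P v) :> C.
Proof. by rewrite natr_sum; apply: eq_bigr => v _; rewrite ccountE. Qed.

Lemma ccount_ker u k : is_last u k -> ccount (fun v => dot u v == 0) = NC / qC.
Proof.
move=> uk; rewrite -ccount_all -(@ccount_slope predT (dot u) (delta_mx 0 k) 1 0) //.
  exact: oner_neq0.
by move=> x t _; rewrite dotDr dotZr dot_delta (is_last1 uk).
Qed.

Lemma ccount_ker2 : ccount (fun v => (dot c v == 0) && (dot c' v == 0)) = NC / qC ^+ 2.
Proof.
have [e [e' [ce ce' c'e c'e']]] := dual_vectors cl cl' ne_c.
rewrite (@ccount_slope _ (dot c') e' 1 0) ?oner_neq0 //.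
- by rewrite (ccount_ker cl); field; exact: qC_neq0.
- by move=> x t; rewrite dotDr dotZr c'e mulr0 addr0.
- by move=> x t _; rewrite dotDr dotZr c'e'.
Qed.

Lemma ccount_ker_dir u k d : is_last u k -> d \in dir_set F k ->
  ccount (fun v => (dot u v == 0) && (dot d v == 0)) = NC / qC ^+ 2.
Proof.
move=> uk /dir_setP[_ dk d0]; have [e [ue de]] := last_indep uk dk d0.
rewrite (@ccount_slope _ (dot d) e 1 0) ?oner_neq0 //.
- by rewrite (ccount_ker uk); field; exact: qC_neq0.
- by move=> x t; rewrite dotDr dotZr ue mulr0 addr0.
- by move=> x t _; rewrite dotDr dotZr de.
Qed.

(** The number of common zeros of c, c' and d. *)
Definition ker_count d : C :=
  ccount (fun v => (dot c v == 0) && (dot c' v == 0) && (dot d v == 0)).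

Lemma ker_count_vanish d : van d -> ker_count d = NC / qC ^+ 2.
Proof.
move=> /vanishesP vd; rewrite -ccount_ker2; apply: eq_ccount => v.
case: eqP => //= cv; case: eqP => //= c'v; by rewrite vd ?eqxx.
Qed.

Lemma ker_count_novanish d : ~~ van d -> ker_count d = NC / qC ^+ 3.
Proof.
move=> /vanishesPn[k [ck c'k dk]]; rewrite /ker_count (@ccount_slope _ (dot d) k (dot d k) 0) //.
- by rewrite ccount_ker2; field; exact: qC_neq0.
- by move=> x t; rewrite !dotDr !dotZr ck c'k mulr0 !addr0.
- by move=> x t _; rewrite dotDr dotZr.
Qed.

Lemma fA2_lform_quad_odd a d :
  fA2 (lform c) (quad c' a d) = if van d then (qC - 1) / qC else 0.
Proof.
case: ifPn => [vd|nvd]; last exact: (fA2_lform_quad_novanish _ cl).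
rewrite /function_A2 pair_coincidence_diff sum_ccount.
under eq_bigr do rewrite ccount_lform_quad.
rewrite big_split /= -!mulr_sumr sumrB.
have := ker_count_vanish vd; have := ccount_ker cl; have := ccount_ker2.
rewrite /ker_count /ccount => -> -> ->.
by field; rewrite qC_neq0 NC_neq0.
Qed.

Lemma fA2_quad_quad_ker a d a' d' : d \in dir_set F l -> d' \in dir_set F l' ->
  fA2 (quad c a d) (quad c' a' d') =
  (1 - qC^-1) ^+ 2 + qC / NC * (NC / qC ^+ 2 - ker_count d')
    + qC / NC * (NC / qC ^+ 2 - ker_count d)
    + qC ^+ 2 / NC * ccount (fun v => (dot c v == 0) && (dot c' v == 0)
                             && (dot d v == 0) && (dot d' v == 0)) - 1.
Proof.
move=> dl dl'; rewrite /function_A2 pair_coincidence_diff sum_ccount.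
under eq_bigr do rewrite ccount_quad_quad.
rewrite !big_split /= -!mulr_sumr !big_split /= !sumrN.
have := ccount_ker_dir cl dl; have := ccount_ker_dir cl' dl'.
have := ccount_ker cl; have := ccount_ker cl'; have := ccount_ker2.
rewrite /ker_count /ccount => -> -> -> -> ->.
have -> : \sum_(v : V) 1 = NC by rewrite sumr_const.
by field; rewrite qC_neq0 NC_neq0.
Qed.

Lemma fA2_quad_quad_vanish a d a' d' : d \in dir_set F l -> d' \in dir_set F l' ->
  van d -> van d' -> fA2 (quad c a d) (quad c' a' d') = (qC - 1) ^+ 2 / qC ^+ 2.
Proof.
move=> dl dl' vd vd'; rewrite fA2_quad_quad_ker // !ker_count_vanish //.
rewrite (eq_ccount (Q := fun v => (dot c v == 0) && (dot c' v == 0))) => [|v].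
  by rewrite ccount_ker2; field; rewrite qC_neq0 NC_neq0.
case: eqP => //= cv; case: eqP => //= c'v.
by rewrite (vanishesP _ _ _ vd) // (vanishesP _ _ _ vd') // eqxx.
Qed.

(** If d and d' do not cut out the same subspace of the common kernel of c and
    c', a direction on which one vanishes and the other does not makes the
    columns orthogonal; otherwise all the kernels are known. *)
Lemma fA2_quad_quad_novanish a d a' d' : d \in dir_set F l -> d' \in dir_set F l' ->
  ~~ (van d && van d') ->
  fA2 (quad c a d) (quad c' a' d') \in [:: 0; (qC - 1) / qC ^+ 2].
Proof.
move=> dl dl' nv; rewrite !inE.
(* W u v: on the common kernel of c and c', the zeros of u are zeros of v. *)
pose W u v := [forall x, (dot c x == 0) && (dot c' x == 0) && (dot u x == 0) ==> (dot v x == 0)].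
have WPn u v : ~~ W u v -> exists x, [/\ dot c x = 0, dot c' x = 0, dot u x = 0 & dot v x != 0].
  move=> /forallPn[x]; rewrite negb_imply => /andP[/andP[/andP[/eqP ? /eqP ?] /eqP ?] ?].
  by exists x.
have [W1|/WPn[k [ck c'k dk dk']]] := boolP (W d d'); last first.
  by rewrite (fA2_quad_slope C cl a a' dl ck c'k dk dk') // eqxx.
have [W2|/WPn[k [ck c'k dk dk']]] := boolP (W d' d); last first.
  by rewrite fA2C (fA2_quad_slope C cl' a' a dl' c'k ck dk dk') // eqxx.
have Wv u w : W u w -> van u -> van w.
  move=> /forallP H /vanishesP vu; apply/vanishesP => x cx c'x.
  by have := H x; rewrite cx c'x vu // eqxx => /eqP.
have nvd : ~~ van d by apply: contra nv => vd; rewrite vd (Wv _ _ W1).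
have nvd' : ~~ van d' by apply: contra nv => vd'; rewrite vd' (Wv _ _ W2).
apply/orP; right; apply/eqP; rewrite fA2_quad_quad_ker // !ker_count_novanish //.
rewrite (eq_ccount (Q := fun v => (dot c v == 0) && (dot c' v == 0) && (dot d v == 0))) => [|v].
  have := ker_count_novanish nvd; rewrite /ker_count => ->.
  by field; rewrite qC_neq0 NC_neq0.
have := forallP W1 v; case: (_ && _ && _) => //= /eqP->; exact: eqxx.
Qed.

End OddCount.

(** * Counting solutions of quadratic equations *)

Section Roots.

Variable F : finFieldType.
Implicit Types t A B : F.

Lemma card_roots (p : {poly F}) (P : pred F) : p != 0 ->
  (forall t, P t -> root p t) -> (#|[set t | P t]| < size p)%N.
Proof.
move=> p0 Pp; rewrite cardE; apply: max_poly_roots => //; last exact: enum_uniq.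
by apply/allP => t; rewrite mem_enum inE => /Pp.
Qed.

Lemma size_monic_quadratic A B : size ('X^2 + A *: 'X + B%:P : {poly F}) = 3%N.
Proof.
rewrite -addrA size_polyDl size_polyXn // (leq_ltn_trans (size_polyD _ _)) //.
rewrite gtn_max (leq_ltn_trans (size_scale_leq _ _)) ?size_polyX //.
by rewrite (leq_ltn_trans (size_polyC_leq1 _)).
Qed.

Lemma card_quadratic A B : (#|[set t | (t ^+ 2 + A * t + B == 0)%R]| <= 2)%N.
Proof.
rewrite -ltnS -(size_monic_quadratic A B); apply: card_roots => [|t].
  by rewrite -size_poly_eq0 size_monic_quadratic.
by rewrite rootE !hornerE.
Qed.

(** Two conics of this shape have at most four common points: either the first
    equation determines p.2 from p.1, and p.1 is a root of a quartic, or it is a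
    quadratic equation in p.1 alone. *)
Lemma card_conics A B al be ga ga' :
  (#|[set p : F * F | (p.1 ^+ 2 + A * p.1 + be * p.2 + ga == 0)%R
                    & (p.2 ^+ 2 + B * p.2 + al * p.1 + ga' == 0)%R]| <= 4)%N.
Proof.
have [->|be0] := eqVneq be 0.
  rewrite card_set_sum -(pair_bigA _ (fun t u => (((t ^+ 2 + A * t + 0 * u + ga == 0)
    && (u ^+ 2 + B * u + al * t + ga' == 0))%R : nat))) /=.
  apply: (@leq_trans (\sum_(t in [set t | (t ^+ 2 + A * t + ga == 0)%R]) 2)%N).
    rewrite [leqRHS]big_mkcond; apply: leq_sum => t _; rewrite inE.
    under eq_bigr do rewrite mul0r addr0.
    case: (_ == 0) => /=; last by rewrite big1.
    rewrite -card_set_sum; apply: leq_trans (card_quadratic B (al * t + ga')).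
    by apply/subset_leq_card/subsetP => u; rewrite !inE addrA.
  by rewrite sum_nat_const (leq_mul2r 2 _ 2) card_quadratic orbT.
pose r : {poly F} := 'X^2 + A *: 'X + ga%:P.
(* The quartic obtained by eliminating p.2, multiplied by be ^ 2. *)
pose p : {poly F} := r ^+ 2 - (B * be) *: r + (al * be ^+ 2) *: 'X + (ga' * be ^+ 2)%:P.
have sz_r : size r = 3%N by apply: size_monic_quadratic.
have r_monic : r \is monic.
  rewrite monicE lead_coefE sz_r /= /r !coefD coefXn coefZ coefX coefC /=.
  by rewrite mulr0 !addr0.
have sz_r2 : size (r ^+ 2) = 5%N by rewrite expr2 size_Mmonic ?monic_neq0 // sz_r.
have sz_p : size p = 5%N.
  rewrite /p -!addrA size_polyDl sz_r2 //.
  rewrite (leq_ltn_trans (size_polyD _ _)) // gtn_max size_polyN.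
  rewrite (leq_ltn_trans (size_scale_leq _ _)) ?sz_r //=.
  rewrite (leq_ltn_trans (size_polyD _ _)) // gtn_max.
  rewrite (leq_ltn_trans (size_scale_leq _ _)) ?size_polyX //=.
  by rewrite (leq_ltn_trans (size_polyC_leq1 _)).
rewrite -(card_in_imset (f := fst)); last first.
  case=> [t u] [t' u']; rewrite !inE /= => /andP[/eqP E _] /andP[/eqP E' _] tt.
  subst t'; congr (_, _); apply: (mulfI be0); apply/eqP; rewrite -subr_eq0.
  by have /eqP := congr2 (fun x y => x - y) E E'; rewrite subrr; congr (_ == 0); ring.
rewrite -ltnS -sz_p.
have -> : fst @: [set p : F * F | (p.1 ^+ 2 + A * p.1 + be * p.2 + ga == 0)%R
                    & (p.2 ^+ 2 + B * p.2 + al * p.1 + ga' == 0)%R]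
   = [set t | t \in fst @: [set p : F * F | (p.1 ^+ 2 + A * p.1 + be * p.2 + ga == 0)%R
                    & (p.2 ^+ 2 + B * p.2 + al * p.1 + ga' == 0)%R]].
  by apply/setP => t; rewrite inE.
apply: card_roots => [|_ /imsetP[[t u] + ->]].
  by rewrite -size_poly_eq0 sz_p.
rewrite inE /= => /andP[/eqP E /eqP E']; rewrite rootE.
have Er : r.[t] = - (be * u).
  by apply/eqP; rewrite -subr_eq0 opprK -[X in _ == X]E !hornerE; apply/eqP; ring.
clearbody r; have <- : be ^+ 2 * (u ^+ 2 + B * u + al * t + ga') = p.[t].
  by rewrite /p !(hornerD, hornerN, hornerZ, hornerX, hornerC, horner_exp) Er; ring.
by rewrite E' mulr0.
Qed.

Lemma quadratic_vanish P Q : (2 < #|F|)%N ->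
  (forall t, P * t ^+ 2 + Q * t = 0) -> P = 0 /\ Q = 0.
Proof.
move=> q2 PQ0.
have [t t01] : exists t, t \notin [set 0; 1 : F].
  apply/existsP; apply: contraLR q2 => /existsPn H; rewrite -leqNgt.
  have -> : 2%N = #|[set 0; 1 : F]| by rewrite cards2 eq_sym oner_eq0.
  apply/subset_leq_card/subsetP => t _; by have := H t; rewrite negbK.
have [t0 t1] : t != 0 /\ t - 1 != 0.
  by move: t01; rewrite !inE negb_or subr_eq0 => /andP.
have E1 := PQ0 1; have Et := PQ0 t.
have EP : P = 0.
  apply: (mulIf (mulf_neq0 t0 t1)); rewrite mul0r.
  rewrite -[RHS](subrr 0) -{1}Et -(mulr0 t) -E1; ring.
by split=> //; move: E1; rewrite EP mul0r add0r mulr1.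
Qed.

End Roots.

(** * Even order: additive columns *)

Section EvenCharacteristic.

Variables (F : finFieldType) (n : nat) (C : numClosedFieldType).
Implicit Types (c d x y v : 'rV[F]_n) (a b t : F) (f g : pfun F n).
Local Notation V := 'rV[F]_n.
Local Notation q := #|F|.
Local Notation N := #|{: 'rV[F]_n}|.
Local Notation qC := (#|F|%:R : C).
Local Notation NC := (#|{: 'rV[F]_n}|%:R : C).
Local Notation fA2 := (function_A2 C).

(** Additivity: in characteristic 2 it holds for all the columns considered. *)
Definition fadditive f : Prop := forall x y, f (x + y) = f x + f y.

(** The level combinations of the pair f, g. *)
Definition pair_image f g : {set F * F} := [set (f x, g x) | x : V].

(** The common zeros of f and g: the kernel of (f, g) when f and g are additive. *)
Definition pair_ker f g : {set V} := [set x | (f x == 0) && (g x == 0)].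

Lemma pair_coincidence_additive f g : fadditive f -> fadditive g ->
  pair_coincidence f g = (N * #|pair_ker f g|)%N.
Proof.
move=> fD gD; rewrite pair_coincidence_diff.
rewrite (eq_bigr (fun v => if v \in pair_ker f g then N else 0%N)) => [|v _].
  by rewrite -big_mkcond sum_nat_const mulnC.
have addE (u w : F) : (u + w == u) = (w == 0) by rewrite -subr_eq0 addrC addKr.
transitivity #|[set y : V | v \in pair_ker f g]|.
  by apply: eq_card => y; rewrite !inE fD gD !addE.
case: ifP => _; first by apply: eq_card => y; rewrite inE.
by apply: eq_card0 => y; rewrite inE.
Qed.

Lemma fA2_additive_ker f g : fadditive f -> fadditive g ->
  fA2 f g = qC ^+ 2 * #|pair_ker f g|%:R / NC - 1.
Proof.
move=> fD gD; rewrite /function_A2 pair_coincidence_additive // natrM.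
by field; exact: NC_neq0.
Qed.

Lemma fadditive0 f : fadditive f -> f 0 = 0.
Proof. by move=> fD; apply: (@addrI _ (f 0)); rewrite -fD !addr0. Qed.

Lemma fadditiveN f x : fadditive f -> f (- x) = - f x.
Proof.
by move=> fD; apply/eqP; rewrite -addr_eq0 -fD addNr fadditive0.
Qed.

Lemma card_pair_fiber f g x : fadditive f -> fadditive g ->
  #|[set y | (f y, g y) == (f x, g x)]| = #|pair_ker f g|.
Proof.
move=> fD gD; apply/esym.
rewrite -(card_imset (pair_ker f g) (addrI x)); apply: eq_card => y.
rewrite [RHS]inE xpair_eqE.
apply/imsetP/andP => [[k + ->]|[/eqP fy /eqP gy]].
  by rewrite inE fD gD => /andP[/eqP-> /eqP->]; rewrite !addr0.
exists (y - x); last by rewrite addrC subrK.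
by rewrite inE fD gD !fadditiveN // fy gy !subrr eqxx.
Qed.

Lemma card_pair_image f g : fadditive f -> fadditive g ->
  (#|pair_image f g| * #|pair_ker f g| = N)%N.
Proof.
move=> fD gD; rewrite -sum_nat_const -[RHS]sum1_card.
rewrite (partition_big (fun x => (f x, g x)) (mem (pair_image f g))) /=; last first.
  by move=> x _; apply: imset_f.
by apply: eq_bigr => _ /imsetP[x _ ->]; rewrite sum1dep_card card_pair_fiber.
Qed.

Lemma pair_ker_gt0 f g : fadditive f -> fadditive g -> (0 < #|pair_ker f g|)%N.
Proof.
by move=> fD gD; rewrite (cardD1 0) inE !fadditive0 // eqxx.
Qed.

Lemma fA2_additive_image f g : fadditive f -> fadditive g ->
  fA2 f g = qC ^+ 2 / #|pair_image f g|%:R - 1.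
Proof.
move=> fD gD; rewrite fA2_additive_ker // -(card_pair_image fD gD) natrM.
have k0 : #|pair_ker f g|%:R != 0 :> C by rewrite pnatr_eq0 -lt0n pair_ker_gt0.
have i0 : #|pair_image f g|%:R != 0 :> C.
  rewrite pnatr_eq0 -lt0n; have := N_gt0 F n.
  by rewrite -(card_pair_image fD gD) muln_gt0 => /andP[].
by field; rewrite k0 i0.
Qed.

Hypothesis evq : ~~ odd q.

Lemma char2_add (t : F) : t + t = 0.
Proof.
have [+ _] := even_card_pchar2 evq; rewrite inE => /andP[_ /eqP two0].
by rewrite -mulr2n -mulr_natl two0 mul0r.
Qed.

Lemma lform_additive c : fadditive (lform c).
Proof. by move=> x y; rewrite !ffunE dotDr. Qed.

Lemma quad_additive c a d : fadditive (quad c a d).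
Proof.
move=> x y; rewrite !ffunE !dotDr; apply/eqP; rewrite -subr_eq0; apply/eqP.
by rewrite -[RHS](char2_add (dot c x * dot c y)); ring.
Qed.

Lemma block_additive c l f : is_last c l -> f \in block c l -> fadditive f.
Proof.
move=> cl; move: f; apply: (block_ind (l := l)) => [|a d _].
  exact: lform_additive.
exact: quad_additive.
Qed.

(** The image of (f, g) is an additive subgroup of F^2, and its order divides N,
    hence is a power of 2; so its index is 1, 2 or 4 if it is at most 4. *)
Lemma fA2_small_ker f g : fadditive f -> fadditive g ->
  (#|pair_ker f g| * q ^ 2 <= 4 * N)%N ->
  exists2 i, (i <= 2)%N & fA2 f g = (2 ^ i)%:R - 1 /\ (#|pair_image f g| * 2 ^ i = q ^ 2)%N.
Proof.
move=> fD gD small.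
have [_ [m Eq]] := even_card_pchar2 evq.
have EN : N = (2 ^ (m * n))%N by rewrite card_mx Eq mul1n expnM.
have [j Ej] : exists j, #|pair_image f g| = (2 ^ j)%N.
  have : (#|pair_image f g| %| 2 ^ (m * n))%N.
    by rewrite -EN -(card_pair_image fD gD) dvdn_mulr.
  by case/(dvdn_pfactor _ _ (isT : prime 2)) => j _ ->; exists j.
have le_j : (j <= m * 2)%N.
  rewrite -(@leq_exp2l 2) // -Ej expnM -Eq; apply: leq_trans (max_card _) _.
  by rewrite card_prod mulnn.
have ge_j : (m * 2 <= j + 2)%N.
  rewrite -(@leq_exp2l 2) // expnD -Ej expnM -Eq.
  rewrite -(leq_pmul2l (pair_ker_gt0 fD gD)) (leq_trans small) //.
  by rewrite -(card_pair_image fD gD); lia.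
have Ei : (#|pair_image f g| * 2 ^ (m * 2 - j) = q ^ 2)%N.
  by rewrite Ej -expnD subnKC // expnM -Eq.
exists (m * 2 - j)%N; first by lia.
split=> //; rewrite fA2_additive_image // -natrX -Ei natrM.
by rewrite mulrAC divff ?mul1r // pnatr_eq0 Ej expn_eq0.
Qed.

(** A bound on the number of zeros in each translate of the plane spanned by e
    and e' bounds the total number of zeros. *)
Lemma small_ker_plane f g e e' :
  (forall y, (#|[set p : F * F | (f (y + (p.1 *: e + p.2 *: e')) == 0)%R
                    & (g (y + (p.1 *: e + p.2 *: e')) == 0)%R]| <= 4)%N) ->
  (#|pair_ker f g| * q ^ 2 <= 4 * N)%N.
Proof.
move=> le4.
have -> : (#|pair_ker f g| * q ^ 2 = \sum_(p : F * F) \sum_y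
    ((f (y + (p.1 *: e + p.2 *: e')) == 0) && (g (y + (p.1 *: e + p.2 *: e')) == 0))%R)%N.
  rewrite -mulnn -card_prod mulnC -sum_nat_const; apply: eq_bigr => p _.
  by rewrite card_set_sum (reindex_inj (addIr (p.1 *: e + p.2 *: e'))).
rewrite exchange_big mulnC -sum_nat_const; apply: leq_sum => y _.
by rewrite -card_set_sum.
Qed.

Lemma quad_plane c u w a d y t t' :
  quad c a d (y + (t *: u + t' *: w)) =
  (dot c y + (t * dot c u + t' * dot c w)) ^+ 2
  + a * (dot c y + (t * dot c u + t' * dot c w)) + (dot d y + (t * dot d u + t' * dot d w)).
Proof. by rewrite !ffunE !dotDr !dotZr. Qed.

Lemma small_ker_lforms c c' l l' : is_last c l -> is_last c' l' -> c != c' ->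
  (#|pair_ker (lform c) (lform c')| * q ^ 2 <= 4 * N)%N.
Proof.
move=> cl cl' ne; have [e [e' [ce c'e ce' c'e']]] := dual_vectors cl cl' ne.
apply: (small_ker_plane (e := e) (e' := e')) => y.
apply: (@leq_trans 1) => //; rewrite -[leqRHS](cards1 (- dot c y, - dot c' y)).
apply/subset_leq_card/subsetP => -[t u]; rewrite !inE !ffunE !dotDr !dotZr /=.
rewrite ce ce' c'e c'e' !mulr0 !mulr1 addr0 add0r xpair_eqE.
by rewrite -!(addrC t) -!(addrC u) !addr_eq0.
Qed.

Lemma small_ker_lform_quad c c' l l' a d : is_last c l -> is_last c' l' -> c != c' ->
  (#|pair_ker (lform c) (quad c' a d)| * q ^ 2 <= 4 * N)%N.
Proof.
move=> cl cl' ne; have [e [e' [ce c'e ce' c'e']]] := dual_vectors cl cl' ne.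
apply: (small_ker_plane (e := e) (e' := e')) => y.
pose t0 := - dot c y; pose B := 2 * dot c' y + a + dot d e'.
pose ga := dot c' y ^+ 2 + a * dot c' y + dot d y + t0 * dot d e.
apply: (@leq_trans 2) => //; apply: leq_trans (card_quadratic B ga).
rewrite -[leqRHS](card_imset _ (f := fun u => (t0, u))) => [|u u' []//].
apply/subset_leq_card/subsetP => -[t u]; rewrite inE /= => /andP[/eqP E1 /eqP E2].
have Et : t = t0.
  apply/eqP; rewrite -subr_eq0 -[X in _ == X]E1 ffunE !dotDr !dotZr ce ce' /t0.
  by apply/eqP; ring.
apply/imsetP; exists u; last by rewrite Et.
rewrite inE -[X in _ == X]E2 quad_plane c'e c'e' Et /B /ga; apply/eqP; ring.
Qed.

Lemma small_ker_quads c c' l l' a d a' d' : is_last c l -> is_last c' l' -> c != c' ->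
  (#|pair_ker (quad c a d) (quad c' a' d')| * q ^ 2 <= 4 * N)%N.
Proof.
move=> cl cl' ne; have [e [e' [ce c'e ce' c'e']]] := dual_vectors cl cl' ne.
apply: (small_ker_plane (e := e) (e' := e')) => y.
apply: leq_trans (card_conics (2 * dot c y + a + dot d e)
  (2 * dot c' y + a' + dot d' e') (dot d' e) (dot d e')
  (dot c y ^+ 2 + a * dot c y + dot d y) (dot c' y ^+ 2 + a' * dot c' y + dot d' y)).
apply/subset_leq_card/subsetP => -[t u]; rewrite !inE /= => /andP[/eqP E1 /eqP E2].
apply/andP; split.
  by rewrite -[X in _ == X]E1 quad_plane ce ce'; apply/eqP; ring.
by rewrite -[X in _ == X]E2 quad_plane c'e c'e'; apply/eqP; ring.
Qed.

Lemma pair_kerC f g : pair_ker f g = pair_ker g f.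
Proof. by apply/setP => x; rewrite !inE andbC. Qed.

Lemma small_ker_blocks c c' l l' f g : is_last c l -> is_last c' l' -> c != c' ->
  f \in block c l -> g \in block c' l' -> (#|pair_ker f g| * q ^ 2 <= 4 * N)%N.
Proof.
move=> cl cl' ne fB gB; move: f fB; apply: block_ind => [|a d dl].
  move: g gB; apply: block_ind => [|a' d' dl'].
    exact: small_ker_lforms cl cl' ne.
  exact: small_ker_lform_quad cl cl' ne.
move: g gB; apply: block_ind => [|a' d' dl'].
  by rewrite pair_kerC; apply: small_ker_lform_quad cl' cl _; rewrite eq_sym.
exact: small_ker_quads cl cl' ne.
Qed.

End EvenCharacteristic.

(** * Order four: fully aliased pairs *)

Section OrderFour.

Variables (F : finFieldType) (n : nat) (C : numClosedFieldType).
Implicit Types (c d x y v : 'rV[F]_n) (a b t : F) (f g : pfun F n).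
Local Notation V := 'rV[F]_n.
Local Notation q := #|F|.
Local Notation N := #|{: 'rV[F]_n}|.
Local Notation fA2 := (function_A2 C).

Hypothesis q4 : q = 4%N.

Let evq : ~~ odd q. Proof. by rewrite q4. Qed.
Let q_gt2 : (2 < q)%N. Proof. by rewrite q4. Qed.

(** The zero set of f has N / 4 points, and the value 3 means that the common
    zero set has N / 4 points too. *)
Lemma fA2_eq3P f g : fadditive f -> fadditive g -> fbalanced f ->
  reflect (forall x, f x = 0 -> g x = 0) (fA2 f g == 3).
Proof.
move=> fD gD balf.
have sub : pair_ker f g \subset [set x | f x == 0].
  by apply/subsetP => x; rewrite !inE => /andP[].
have E3 : (fA2 f g == 3) = (#|pair_ker f g| == #|[set x | f x == 0%R]|).
  rewrite -(eqn_pmul2r (isT : (0 < 4)%N)) -{2}q4 balf.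
  have N0 := NC_neq0 F n C.
  rewrite -(eqr_nat C) -subr_eq0 -[RHS]subr_eq0 (fA2_additive_ker C) // q4 natrM.
  set K := #|pair_ker f g|%:R : C; set M := _%:R in N0 *.
  have -> : 4 ^+ 2 * K / M - 1 - 3 = 4 / M * (K * 4 - M) by field.
  by rewrite !mulf_eq0 invr_eq0 (negPf N0) pnatr_eq0.
rewrite E3; apply: (iffP eqP) => [Ecard x /eqP fx|H].
  have /eqP EK : pair_ker f g == [set x | f x == 0] by rewrite eqEcard sub Ecard leqnn.
  by have : x \in pair_ker f g; [rewrite EK inE | rewrite inE fx => /eqP].
apply: eq_card => x; rewrite !inE; case: eqP => //= fx.
by rewrite H ?eqxx.
Qed.

Lemma pow4 t : t ^+ 4 = t.
Proof. by rewrite -q4 expf_card. Qed.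

(** If l = l', both combinations are the normalization of c + c'; if l < l',
    the second one is c, and the first one is normalized because c' is. *)
Lemma common_normalization c c' l l' :
  is_last c l -> is_last c' l' -> c != c' ->
  exists nu al be, [/\ nu != 0, al *: c + nu *: c' \in dir_set F l
                     & nu *: c + be *: c' \in dir_set F l'].
Proof.
wlog le_l : c c' l l' / (l <= l')%N => [wl cl cl' ne|cl cl' ne].
  have [le_l|/ltnW le_l] := leqP l l'; first exact: wl.
  have [|nu [al [be [nu0 H1 H2]]]] := wl c' c l' l le_l cl' cl; first by rewrite eq_sym.
  by exists nu, be, al; split=> //; rewrite addrC.
move: le_l; rewrite leq_eqVlt => /orP[/eqP/val_inj El|lt_l].
  subst l'; have d0 : c + c' != 0.
    apply: contraNneq ne => /(congr1 (fun d => d - c' + (c' + c'))).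
    have -> : c' + c' = 0 by apply/rowP => i; rewrite !mxE (char2_add evq).
    rewrite addrK addr0 => ->; apply/eqP/rowP => i; rewrite !mxE addr0 sub0r.
    by apply/eqP; rewrite eq_sym -addr_eq0 (char2_add evq).
  have [t t0 nt] := normalize_scale d0.
  exists t, t, t; rewrite -scalerDr inE nt !mxE (is_last1 cl) (is_last1 cl').
  by rewrite (char2_add evq) mulr0 eqxx.
exists 1, (- c' 0 l), 0; rewrite oner_neq0 !scale1r scale0r addr0 !inE.
split=> //.
  apply/andP; split; last by rewrite !mxE (is_last1 cl) mulr1 addNr.
  apply/normalizedP; exists l'; rewrite /is_last !mxE (is_lastP cl lt_l) mulr0 add0r.
  rewrite (is_last1 cl') eqxx /=; apply/forallP => j; apply/implyP => lt_j.
  by rewrite !mxE (is_lastP cl (ltn_trans lt_l lt_j)) (is_lastP cl' lt_j) mulr0 addr0.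
by rewrite (is_lastP cl lt_l) eqxx andbT; apply/normalizedP; exists l.
Qed.

Lemma fA2_lform_quad_neq3 c c' l l' a d : is_last c l -> is_last c' l' -> c != c' ->
  fA2 (lform c) (quad c' a d) != 3.
Proof.
move=> cl cl' ne; have [e [e' [_ _ ce' c'e']]] := dual_vectors cl cl' ne.
apply/(fA2_eq3P (@lform_additive F n c) (quad_additive evq c' a d) (lform_balanced cl)) => H.
have Q t : 1 * t ^+ 2 + (a + dot d e') * t = 0.
  rewrite -[RHS](H (t *: e')) ?ffunE !dotZr ?ce' ?mulr0 // c'e'; ring.
by have [/eqP] := quadratic_vanish q_gt2 Q; rewrite oner_eq0.
Qed.

(** If d does not vanish on the common kernel, there is a line on which c and d
    vanish and c' does not; the second column would have to vanish on this line,
    where it is a monic quadratic polynomial. *)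
Lemma fA2_eq3_vanishes c c' l l' a d a' d' : is_last c l -> is_last c' l' -> c != c' ->
  (forall x, quad c a d x = 0 -> quad c' a' d' x = 0) -> vanishes c c' d.
Proof.
move=> cl cl' ne H; have [e [e' [_ _ ce' c'e']]] := dual_vectors cl cl' ne.
apply: contraT => /vanishesPn[k [ck c'k dk]].
(* The line spanned by x0 is the one on which c and d vanish and c' does not. *)
pose x0 := e' - (dot d e' / dot d k) *: k.
have [cx c'x dx] : [/\ dot c x0 = 0, dot c' x0 = 1 & dot d x0 = 0].
  rewrite !dotDr !dotNr !dotZr ck c'k ce' c'e'.
  by split; [ring|ring|rewrite divfK ?subrr].
have Q t : 1 * t ^+ 2 + (a' + dot d' x0) * t = 0.
  rewrite -[RHS](H (t *: x0)) ?ffunE !dotZr ?cx ?dx ?c'x; ring.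
by have [/eqP] := quadratic_vanish q_gt2 Q; rewrite oner_eq0.
Qed.

(** Exactly one pair of quadratic columns of two distinct sets Q_h has value 3. *)
Lemma fA2_quads_eq3 c c' l l' : is_last c l -> is_last c' l' -> c != c' ->
  exists a0 d0 a0' d0', [/\ d0 \in dir_set F l, d0' \in dir_set F l' &
    forall a d a' d', d \in dir_set F l -> d' \in dir_set F l' ->
    (fA2 (quad c a d) (quad c' a' d') == 3) =
    [&& a == a0, d == d0, a' == a0' & d' == d0'] ].
Proof.
move=> cl cl' ne; have [nu [al [be [nu0 dl0 dl0']]]] := common_normalization cl cl' ne.
set d0 := al *: c + _ in dl0; set d0' := nu *: c + _ in dl0'.
have [e [e' [ce c'e ce' c'e']]] := dual_vectors cl cl' ne.
have van0 : vanishes c c' d0 by apply: vanishes_lin.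
have van0' : vanishes c c' d0' by apply: vanishes_lin.
have nu3 : nu ^+ 3 = 1 by apply: (mulIf nu0); rewrite mul1r -exprSr pow4.
exists al, d0, be, d0'; split=> // a d a' d' dl dl'.
have bal u : fbalanced (quad c u d) by apply: (block_balanced cl); apply: quad_in_block.
have F3 := fA2_eq3P (quad_additive evq c a d) (quad_additive evq c' a' d') (bal a).
have add2 := char2_add evq.
apply/F3/and4P => [H|[/eqP-> /eqP-> /eqP-> /eqP->] x]; last first.
  rewrite !ffunE /d0 /d0' !dotDl !dotZl; set t := dot c x; set t' := dot c' x => E.
  have Et : t' = - (nu ^+ 2 * t ^+ 2).
    apply/eqP; rewrite -subr_eq0 opprK -[X in _ == X](mulr0 (nu ^+ 2)) -E; apply/eqP.
    rewrite -[LHS]addr0 -[in LHS](mulr0 (nu ^+ 2 * al * t)) -(add2 1).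
    transitivity (nu ^+ 3 * t' + nu ^+ 2 * t ^+ 2 + nu ^+ 2 * al * t * (1 + 1)); last by ring.
    by rewrite nu3 mul1r.
  rewrite Et; transitivity (nu ^+ 4 * t ^+ 4 + nu * t - be * nu ^+ 2 * t ^+ 2 * (1 + 1)).
    by ring.
  by rewrite !pow4 !add2 mulr0 subr0.
have vd : vanishes c c' d by apply: (fA2_eq3_vanishes cl cl' ne H).
have H' x : quad c' a' d' x = 0 -> quad c a d x = 0.
  apply/(fA2_eq3P (quad_additive evq c' a' d') (quad_additive evq c a d)).
    by apply: (block_balanced cl'); apply: quad_in_block.
  by rewrite fA2C; apply/F3.
have vd' : vanishes c c' d'.
  by rewrite vanishesC; apply: (fA2_eq3_vanishes cl' cl _ H'); rewrite eq_sym.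
have [d1 U] := unique_vanishing_dir cl cl' ne.
have [|d1' U'] := unique_vanishing_dir cl' cl; first by rewrite eq_sym.
have Ed : d = d0.
  have /eqP := U d; rewrite dl vd => /eqP/esym/eqP->.
  by have /eqP := U d0; rewrite dl0 van0 => /eqP/esym/eqP->.
have Ed' : d' = d0'.
  have /eqP := U' d'; rewrite dl' vanishesC vd' => /eqP/esym/eqP->.
  by have /eqP := U' d0'; rewrite dl0' vanishesC van0' => /eqP/esym/eqP->.
rewrite Ed Ed' !eqxx; move: H; rewrite Ed Ed' => H.
pose A := a + al; pose B := a' + be.
(* The first column vanishes at the points x; so does the second one, which is
   there a quadratic polynomial in t because t ^ 4 = t and nu ^ 3 = 1. *)
have Q t : (nu * A ^+ 2 - B * nu ^+ 2) * t ^+ 2 + (nu ^+ 4 * (1+1) - A * B * nu ^+ 2) * t = 0.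
  pose x := t *: e + (- (nu ^+ 2 * (t ^+ 2 + A * t))) *: e'.
  have [cx c'x] : dot c x = t /\ dot c' x = - (nu ^+ 2 * (t ^+ 2 + A * t)).
    by rewrite !dotDr !dotZr ce ce' c'e c'e'; split; ring.
  have := H x; rewrite !ffunE /d0 /d0' !dotDl !dotZl cx c'x => Hx.
  have {Hx} <- := Hx _; last first.
    transitivity ((t ^+ 2 + A * t) * (1 - nu ^+ 3)); first by rewrite /A; ring.
    by rewrite nu3 subrr mulr0.
  rewrite pow4; transitivity (nu ^+ 4 * (t ^+ 4 + (A * t ^+ 3 + A * t ^+ 3) + A ^+ 2 * t ^+ 2)
     - B * nu ^+ 2 * (t ^+ 2 + A * t) + nu * t); last by rewrite /B; ring.
  by rewrite !pow4 (add2 (A * t ^+ 3)); ring.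
have [P0 Q0] := quadratic_vanish q_gt2 Q.
have nu2 : nu ^+ 2 != 0 by rewrite expf_neq0.
have AB0 : A * B = 0.
  move: Q0; rewrite add2 mulr0 sub0r => /eqP.
  by rewrite oppr_eq0 mulf_eq0 (negPf nu2) orbF => /eqP.
have A0 : A = 0.
  move/eqP: AB0; rewrite mulf_eq0 => /orP[/eqP//|/eqP B0].
  move: P0; rewrite B0 mul0r subr0 => /eqP.
  by rewrite mulf_eq0 (negPf nu0) expf_eq0 /= => /eqP.
have B0 : B = 0.
  move: P0; rewrite A0 expr0n mulr0 sub0r => /eqP.
  by rewrite oppr_eq0 mulf_eq0 (negPf nu2) orbF => /eqP.
have eq2 (u w : F) : u + w = 0 -> u == w.
  by move/eqP; rewrite addr_eq0 => /eqP->; rewrite eq_sym -addr_eq0 add2.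
by split=> //; apply: eq2.
Qed.

Lemma sum_full_blocks c c' l l' : is_last c l -> is_last c' l' -> c != c' ->
  (\sum_(f in block c l) \sum_(g in block c' l') ((fA2 f g == 3)%R : nat))%N = 1%N.
Proof.
move=> cl cl' ne; have [a0 [d0 [a0' [d0' [dl0 dl0' E]]]]] := fA2_quads_eq3 cl cl' ne.
have ne' : c' != c by rewrite eq_sym.
rewrite (sum_block cl) (sum_block cl').
have z3 : (0 == 3 :> C) = false by rewrite eq_sym pnatr_eq0.
rewrite (fA2_lforms C cl cl' ne) z3 /= add0r.
rewrite big1 ?add0r => [|a _]; last first.
  by rewrite big1 // => d dl; rewrite (negPf (fA2_lform_quad_neq3 _ _ cl cl' ne)).
rewrite (bigD1 a0) //= (bigD1 d0) //= (sum_block cl').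
rewrite fA2C (negPf (fA2_lform_quad_neq3 _ _ cl' cl ne')) /= add0r.
rewrite (bigD1 a0') //= (bigD1 d0') //= E // !eqxx /=.
rewrite !big1 //.
- move=> a ne_a; rewrite big1 // => d dl; rewrite (sum_block cl').
  rewrite fA2C (negPf (fA2_lform_quad_neq3 _ _ cl' cl ne')) /= add0r big1 // => a' _.
  by rewrite big1 // => d' dl'; rewrite E // (negPf ne_a).
- move=> d /andP[dl ne_d]; rewrite (sum_block cl').
  rewrite fA2C (negPf (fA2_lform_quad_neq3 _ _ cl' cl ne')) /= add0r big1 // => a' _.
  by rewrite big1 // => d' dl'; rewrite E // (negPf ne_d) andbF.
- by move=> a' ne_a; rewrite big1 // => d' dl'; rewrite E // (negPf ne_a) !andbF.
by move=> d' /andP[dl' ne_d]; rewrite E // (negPf ne_d) !andbF.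
Qed.

End OrderFour.

(** * The design of a sequence of functions *)

Lemma card_ord_count (T : Type) (s : seq T) (P : pred T) :
  #|[set k : 'I_(size s) | P (tnth (in_tuple s) k)]| = count P s.
Proof. by rewrite card_set_sum -sum1_count [RHS]big_mkcond [RHS]big_tnth. Qed.

Lemma sum_pairs_values (C : numDomainType) m (A : 'I_m -> 'I_m -> C) (vs : seq C) :
  uniq vs -> (forall u v : 'I_m, (u < v)%N -> A u v \in vs) ->
  \sum_(p : 'I_m * 'I_m | (p.1 < p.2)%N) A p.1 p.2 =
  \sum_(x <- vs) x * (npairs (fun u v => A u v == x))%:R.
Proof.
move=> vs_uniq Avs.
transitivity (\sum_(p : 'I_m * 'I_m | (p.1 < p.2)%N)
                \sum_(x <- vs) x * (A p.1 p.2 == x)%:R).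
  apply: eq_bigr => p lt_p; rewrite (bigD1_seq (A p.1 p.2)) ?Avs //= eqxx mulr1.
  by rewrite big1 ?addr0 // => x; rewrite eq_sym => /negPf->; rewrite mulr0.
rewrite exchange_big; apply: eq_bigr => x _; rewrite -mulr_sumr; congr (_ * _).
rewrite /npairs card_set_sum natr_sum big_mkcond; apply: eq_bigr => p _.
by case: (_ < _)%N.
Qed.

Section FunctionDesign.

Variables (F : finFieldType) (n : nat) (C : numClosedFieldType).
Variable c : 'I_(#|F|.-1) -> F -> C.
Hypothesis hc : orthonormal_contrasts c.
Local Notation V := 'rV[F]_n.
Local Notation q := #|F|.
Local Notation N := #|{: 'rV[F]_n}|.
Local Notation qC := (#|F|%:R : C).
Local Notation NC := (#|{: 'rV[F]_n}|%:R : C).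
Variable cs : seq (pfun F n).
Local Notation col u := (tnth (in_tuple cs) u).

Lemma card_rows (P : pred V) : #|[set i : 'I_N | P (enum_val i)]| = #|[set x | P x]|.
Proof.
by rewrite !card_set_sum -(big_enum_val (A := {: V}) (fun x => P x : nat)).
Qed.

Lemma card_row_pairs (P : V -> pred V) :
  #|[set p : 'I_N * 'I_N | P (enum_val p.1) (enum_val p.2)]|
  = #|[set p : V * V | P p.1 p.2]|.
Proof.
rewrite !card_set_sum -(pair_bigA _ (fun i j : 'I_N => P (enum_val i) (enum_val j) : nat)) /=.
rewrite -(pair_bigA _ (fun x y : V => P x y : nat)) /=.
under eq_bigr do rewrite -card_set_sum card_rows.
rewrite -(big_enum_val (A := {: V}) (fun x => #|[set y | P x y]|)).
by apply: eq_bigr => x _; rewrite card_set_sum.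
Qed.

Lemma cols_balanced : (forall u, fbalanced (col u)) -> balanced (cols_design cs).
Proof.
move=> bal u b; under eq_finset do rewrite mxE.
by rewrite (card_rows (fun x => col u x == b)) -(bal u b) mulnK ?q_gt0.
Qed.

Hypothesis bal : forall u, fbalanced (col u).
Hypothesis qN : (q %| N)%N.

Lemma projA2_fA2 u v : projA2 c (cols_design cs) u v = function_A2 C (col u) (col v).
Proof.
rewrite (projA2_count hc) ?finNzRing_gt1 ?N_gt0 //; last exact: cols_balanced.
rewrite /function_A2; congr (_ * _%:R / _ - _).
under eq_finset do rewrite !mxE.
by rewrite (card_row_pairs (fun x y => (col u x == col u y) && (col v x == col v y))).
Qed.

Lemma cols_design_image u v :
  [set (cols_design cs i u, cols_design cs i v) | i : 'I_N] = pair_image (col u) (col v).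
Proof.
apply/setP => xy; apply/imsetP/imsetP => -[x _ ->].
  by exists (enum_val x) => //; rewrite !mxE.
by exists (enum_rank x) => //; rewrite !mxE enum_rankK.
Qed.

Lemma cols_design_level u v xy :
  level_count (cols_design cs) u v xy = #|[set x | (col u x, col v x) == xy]|.
Proof.
rewrite /level_count; under eq_finset do rewrite !mxE.
by rewrite (card_rows (fun x => (col u x, col v x) == xy)).
Qed.

(** If the t level combinations that occur do so equally often, the projected
    value is q^2 / t - 1. *)
Lemma equal_levels_fA2 u v t : equal_levels (cols_design cs) u v t ->
  projA2 c (cols_design cs) u v = qC ^+ 2 / t%:R - 1.
Proof.
rewrite projA2_fA2 /equal_levels; set f := col u; set g := col v.
have -> : [set (cols_design cs i u, cols_design cs i v) | i : 'I_N] = pair_image f g.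
  exact: cols_design_image.
move=> /andP[/eqP imt /forall_inP lev_t].
have {}lev_t xy : xy \in pair_image f g -> #|[set x | (f x, g x) == xy]| = (N %/ t)%N.
  by move=> xyL; rewrite -cols_design_level; apply/eqP/lev_t.
have EN : (t * (N %/ t))%N = N.
  rewrite -{1}imt -sum_nat_const -[RHS]sum1_card.
  rewrite [RHS](partition_big (fun x => (f x, g x)) (mem (pair_image f g))) /=; last first.
    by move=> x _; apply: imset_f.
  by apply: eq_bigr => xy xyL; rewrite sum1dep_card lev_t.
have EM : pair_coincidence f g = (t * (N %/ t) ^ 2)%N.
  rewrite /pair_coincidence card_set_sum.
  rewrite -(pair_bigA _ (fun x y => ((f x == f y) && (g x == g y) : nat))) /=.
  rewrite -{1}imt -sum_nat_const.
  rewrite (partition_big (fun x => (f x, g x)) (mem (pair_image f g))) /=; last first.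
    by move=> x _; apply: imset_f.
  apply: eq_bigr => xy xyL.
  rewrite (eq_bigr (fun=> (N %/ t)%N)) => [|x _].
    rewrite sum_nat_const -mulnn; congr (_ * _)%N.
    by rewrite -(lev_t xy xyL) cardsE.
  rewrite -card_set_sum -(lev_t (f x, g x)) ?imset_f //; apply: eq_card => y.
  by rewrite !inE xpair_eqE !(eq_sym (f x)) !(eq_sym (g x)).
have r0 : (N %/ t)%:R != 0 :> C.
  by rewrite pnatr_eq0; apply/eqP => r0; have := N_gt0 F n; rewrite -EN r0 muln0.
have t0 : t%:R != 0 :> C.
  by rewrite pnatr_eq0; apply/eqP => t0; have := N_gt0 F n; rewrite -EN t0.
have EC : NC = t%:R * (N %/ t)%:R by rewrite -natrM EN.
by rewrite /function_A2 EM !natrM EC; field; rewrite r0 t0.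
Qed.

Lemma equal_levels_additive u v t : fadditive (col u) -> fadditive (col v) -> (0 < t)%N ->
  equal_levels (cols_design cs) u v t = (projA2 c (cols_design cs) u v == qC ^+ 2 / t%:R - 1).
Proof.
move=> fD gD t0; apply/idP/eqP => [/equal_levels_fA2 //|].
rewrite projA2_fA2 fA2_additive_image // => /addIr/(mulfI _) E.
have {E} imt : #|pair_image (col u) (col v)| = t.
  apply/eqP; rewrite -(eqr_nat C); apply/eqP/invr_inj/E.
  by rewrite expf_neq0 // qC_neq0.
rewrite /equal_levels.
have -> : [set (cols_design cs i u, cols_design cs i v) | i : 'I_N]
    = pair_image (col u) (col v) by exact: cols_design_image.
rewrite imt eqxx /=; apply/forall_inP => _ /imsetP[x _ ->].
rewrite cols_design_level card_pair_fiber // -{1}(card_pair_image fD gD) imt.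
by rewrite mulKn.
Qed.

End FunctionDesign.

(** * Odd order: sums over two sets Q_h *)

Section OddBlockValues.

Variables (F : finFieldType) (n : nat) (C : numClosedFieldType).
Local Notation q := #|F|.
Local Notation qC := (#|F|%:R : C).
Local Notation fA2 := (function_A2 C).

Hypothesis oddq : odd q.
Hypothesis q_gt2 : (2 < q)%N.

Lemma odd_values_uniq :
  uniq [:: 0; (qC - 1) / qC; (qC - 1) ^+ 2 / qC ^+ 2; (qC - 1) / qC ^+ 2].
Proof.
have q0 : qC != 0 := qC_neq0 F C.
have q1 : qC - 1 != 0 by rewrite subr_eq0 (eqr_nat _ _ 1) gtn_eqF // (ltn_trans _ q_gt2).
have q2 : qC - 2 != 0 by rewrite subr_eq0 eqr_nat gtn_eqF.
have neq (x y : C) : (x - y) * qC ^+ 2 != 0 -> x != y.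
  by apply: contraNneq => ->; rewrite subrr mul0r.
rewrite /= !inE !negb_or; do ![apply/andP; split] => //; apply: neq.
- by rewrite (_ : _ * _ = - (qC - 1) * qC) ?mulf_neq0 ?oppr_eq0 //; field.
- by rewrite (_ : _ * _ = - (qC - 1) ^+ 2) ?oppr_eq0 ?expf_neq0 //; field.
- by rewrite (_ : _ * _ = - (qC - 1)) ?oppr_eq0 //; field.
- by rewrite (_ : _ * _ = (qC - 1)) //; field.
- by rewrite (_ : _ * _ = (qC - 1) ^+ 2) ?expf_neq0 //; field.
by rewrite (_ : _ * _ = (qC - 1) * (qC - 2)) ?mulf_neq0 //; field.
Qed.

Variables (c c' : 'rV[F]_n) (l l' : 'I_n).
Hypothesis cl : is_last c l.
Hypothesis cl' : is_last c' l'.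
Hypothesis ne : c != c'.
Let ne' : c' != c. Proof. by rewrite eq_sym. Qed.

Lemma fA2_quad_lform_odd a d :
  fA2 (quad c a d) (lform c') = if vanishes c c' d then (qC - 1) / qC else 0.
Proof. by rewrite fA2C (fA2_lform_quad_odd _ oddq cl' cl ne') vanishesC. Qed.

Lemma fA2_blocks_odd f g : f \in block c l -> g \in block c' l' ->
  fA2 f g \in [:: 0; (qC - 1) / qC; (qC - 1) ^+ 2 / qC ^+ 2; (qC - 1) / qC ^+ 2].
Proof.
move=> fB gB; move: f fB; apply: block_ind => [|a d dl].
  move: g gB; apply: block_ind => [|a d dl].
    by rewrite (fA2_lforms C cl cl' ne) mem_head.
  by rewrite (fA2_lform_quad_odd _ oddq cl cl' ne); case: ifP; rewrite !inE eqxx ?orbT.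
move: g gB; apply: block_ind => [|a' d' dl'].
  by rewrite fA2_quad_lform_odd; case: ifP; rewrite !inE eqxx ?orbT.
have [/andP[vd vd']|nv] := boolP (vanishes c c' d && vanishes c c' d').
  by rewrite (fA2_quad_quad_vanish _ oddq cl cl' ne _ _ dl dl') // !inE eqxx !orbT.
have := fA2_quad_quad_novanish C oddq cl cl' ne a a' dl dl' nv.
by rewrite !inE => /orP[] ->; rewrite ?orbT.
Qed.

Lemma sum_vanish_pred : \sum_(d in dir_set F l) (vanishes c c' d : nat) = 1%N.
Proof.
rewrite -[RHS](card_vanishing_dir cl cl' ne) -sum1_card [RHS]big_mkcond /=.
by rewrite [LHS]big_mkcond; apply: eq_bigr => d _; rewrite !inE; case: (_ && (_ == 0)).
Qed.

End OddBlockValues.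

Section OddBlockSums.

Variables (F : finFieldType) (n : nat) (C : numClosedFieldType).
Local Notation q := #|F|.
Local Notation qC := (#|F|%:R : C).
Local Notation fA2 := (function_A2 C).

Hypothesis oddq : odd q.
Hypothesis q_gt2 : (2 < q)%N.
Variables (c c' : 'rV[F]_n) (l l' : 'I_n).
Hypothesis cl : is_last c l.
Hypothesis cl' : is_last c' l'.
Hypothesis ne : c != c'.
Let ne' : c' != c. Proof. by rewrite eq_sym. Qed.

Lemma sum_blocks_odd1 :
  (\sum_(f in block c l) \sum_(g in block c' l')
    ((fA2 f g == (qC - 1) / qC)%R : nat) = 2 * q)%N.
Proof.
have := odd_values_uniq C q_gt2; rewrite /= !inE !negb_or.
move=> /and3P[/and3P[/negPf n01 /negPf n02 /negPf n03] /andP[/negPf n12 /negPf n13] _].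
rewrite (sum_block cl) (sum_block cl') (fA2_lforms C cl cl' ne) n01 /= add0r.
transitivity (q + q)%N; last by rewrite mul2n addnn.
congr (_ + _)%N.
  rewrite (eq_bigr (fun=> 1%N)) => [|a _]; first by rewrite sum1_card.
  rewrite -[RHS](sum_vanish_pred cl' cl ne'); apply: eq_bigr => d dl.
  rewrite (fA2_lform_quad_odd _ oddq cl cl' ne) vanishesC.
  by case: ifP; rewrite ?eqxx ?n01.
rewrite (eq_bigr (fun=> 1%N)) => [|a _]; first by rewrite sum1_card.
rewrite -[RHS](sum_vanish_pred cl cl' ne); apply: eq_bigr => d dl.
rewrite (sum_block cl') (fA2_quad_lform_odd C oddq cl cl' ne) big1 => [|a' _].
  by rewrite addr0; case: ifP; rewrite ?eqxx ?n01.
apply: big1 => d' dl'.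
have [/andP[vd vd']|nv] := boolP (vanishes c c' d && vanishes c c' d').
  by rewrite (fA2_quad_quad_vanish _ oddq cl cl' ne _ _ dl dl') // eq_sym n12.
have := fA2_quad_quad_novanish C oddq cl cl' ne a a' dl dl' nv.
by rewrite !inE => /orP[] /eqP->; rewrite ?n01 // eq_sym n13.
Qed.

Lemma sum_blocks_odd2 :
  (\sum_(f in block c l) \sum_(g in block c' l')
    ((fA2 f g == (qC - 1) ^+ 2 / qC ^+ 2)%R : nat) = q ^ 2)%N.
Proof.
have := odd_values_uniq C q_gt2; rewrite /= !inE !negb_or.
move=> /and4P[/and3P[/negPf n01 /negPf n02 /negPf n03] /andP[/negPf n12 /negPf n13] /negPf n23 _].
rewrite (sum_block cl) (sum_block cl') (fA2_lforms C cl cl' ne) n02 /= add0r.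
rewrite big1 ?add0r => [|a _]; last first.
  apply: big1 => d dl; rewrite (fA2_lform_quad_odd _ oddq cl cl' ne).
  by case: ifP; rewrite ?n12 ?n02.
rewrite (eq_bigr (fun=> q)) => [|a _]; first by rewrite sum_nat_const mulnn.
rewrite -[RHS]mul1n -[X in _ = (X * _)%N](sum_vanish_pred cl cl' ne) big_distrl /=; apply: eq_bigr => d dl.
rewrite (sum_block cl') (fA2_quad_lform_odd C oddq cl cl' ne).
rewrite [X in X + _](_ : _ = 0%N) ?add0r; last by case: ifP; rewrite ?n12 ?n02.
rewrite mulnC -sum_nat_const; apply: eq_bigr => a' _.
rewrite -[RHS]mul1n -[X in _ = (X * _)%N](sum_vanish_pred cl' cl ne') big_distrl /=; apply: eq_bigr => d' dl'.
rewrite -vanishesC mulnb andbC.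
have [/andP[vd vd']|nv] := boolP (vanishes c c' d && vanishes c c' d').
  by rewrite (fA2_quad_quad_vanish _ oddq cl cl' ne _ _ dl dl') // eqxx.
have := fA2_quad_quad_novanish C oddq cl cl' ne a a' dl dl' nv.
by rewrite !inE => /orP[] /eqP->; rewrite ?n02 // eq_sym n23.
Qed.

End OddBlockSums.

(** * The juxtaposed design *)

Section Juxtaposition.

Variables (F : finFieldType) (n k : nat) (C : numClosedFieldType).
Variable c : 'I_(#|F|.-1) -> F -> C.
Hypothesis hc : orthonormal_contrasts c.
Local Notation V := 'rV[F]_n.
Local Notation q := #|F|.
Local Notation N := #|{: 'rV[F]_n}|.
Local Notation qC := (#|F|%:R : C).
Local Notation NC := (#|{: 'rV[F]_n}|%:R : C).

Variables (u : 'I_k -> V) (l : 'I_k -> 'I_n).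
Hypothesis ul : forall i, is_last (u i) (l i).
Hypothesis u_inj : injective u.

Local Notation blk i := (block (u i) (l i)).
Variable cs : seq (pfun F n).
Hypothesis csE : cs = flatten [seq enum (blk i) | i <- enum 'I_k].
Local Notation col v := (tnth (in_tuple cs) v).
Local Notation D := (cols_design cs).
Hypothesis k_gt0 : (0 < k)%N.

Lemma col_in_block v : exists i, col v \in blk i.
Proof.
have: col v \in cs by apply: mem_tnth.
rewrite [X in _ \in X]csE => /flatten_mapP[i _].
by rewrite mem_enum; exists i.
Qed.

Lemma col_balanced v : fbalanced (col v).
Proof. by have [j] := col_in_block v; apply: block_balanced. Qed.

Lemma card_dvd_points : (q %| N)%N.
Proof.
by rewrite -(lform_balanced (ul (Ordinal k_gt0)) 0) dvdn_mull.
Qed.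

Lemma size_juxta : (size cs * q.-1 = k * N.-1)%N.
Proof.
have Esz : size cs = (\sum_(i < k) #|blk i|)%N.
  rewrite csE size_flatten /shape -map_comp sumnE big_map big_enum /=.
  by apply: eq_bigr => i _; rewrite -cardE.
rewrite Esz big_distrl /= (eq_bigr (fun=> N.-1)) => [|i _].
  by rewrite sum_nat_const card_ord.
exact: card_block.
Qed.

Lemma juxta_row_weight i i' : i != i' -> row_weight C D i i' = - k%:R.
Proof.
move=> ne; rewrite row_weightE; under eq_finset do rewrite !mxE.
set x := enum_val i; set y := enum_val i'.
have nexy : x != y by rewrite (inj_eq enum_val_inj).
rewrite (@card_ord_count _ cs (fun f => f x == f y)).
(* The coincidences of two distinct rows, block by block. *)
have cntE : count (fun f : pfun F n => f x == f y) cs =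
    (\sum_(j < k) #|[set f in blk j | f x == f y]|)%N.
  rewrite csE count_flatten -map_comp sumnE big_map big_enum /=.
  apply: eq_bigr => j _; rewrite -sum1_count -sum1dep_card.
  by rewrite big_enum_cond.
have q1 : qC - 1 != 0.
  by rewrite subr_eq0 (eqr_nat _ _ 1) gtn_eqF // finNzRing_gt1.
have natr_pred m : (0 < m)%N -> m.-1%:R = m%:R - 1 :> C.
  by move=> m0; rewrite -subn1 natrB.
apply: (mulIf q1).
have szC := congr1 (fun m => m%:R : C) size_juxta.
rewrite !natrM !natr_pred ?q_gt0 ?N_gt0 // in szC.
rewrite mulrBl szC cntE natr_sum mulr_sumr mulr_suml.
rewrite (eq_bigr (fun=> NC - qC)) => [|j _].
  by rewrite sumr_const card_ord -mulr_natr; ring.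
have := congr1 (fun m => m%:R : C) (block_coincidence (ul j) nexy).
rewrite natrM -addn1 natrD natrM natr_pred ?q_gt0 // => <-.
by ring.
Qed.

Lemma juxta_balanced : balanced D.
Proof. exact: cols_balanced col_balanced. Qed.

Lemma juxta_GMA : GMA_optimal c D.
Proof.
apply: (constant_row_weight_GMA hc _ _ _ juxta_balanced juxta_row_weight).
- exact: finNzRing_gt1.
- exact: card_dvd_points.
- exact: N_gt0.
Qed.

Lemma juxta_gwlp2 : gwlp c D 2 = ('C(k, 2) * (N - 1))%:R.
Proof.
apply: (constant_row_weight_gwlp2 hc _ _ _ juxta_balanced _ juxta_row_weight).
- exact: finNzRing_gt1.
- exact: card_dvd_points.
- exact: N_gt0.
- by rewrite !subn1 size_juxta.
Qed.

Lemma juxta_projA2 v w : projA2 c D v w = function_A2 C (col v) (col w).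
Proof. exact: (projA2_fA2 hc col_balanced card_dvd_points). Qed.

(** A property that fails for distinct columns of the same Q_h, and holds for t
    pairs of columns of any two distinct Q_h, holds for C(k, 2) t pairs. *)
Lemma npairs_juxta (P : pfun F n -> pfun F n -> bool) t
    (Q : 'I_(size cs) -> 'I_(size cs) -> bool) :
  (forall v w, Q v w = P (col v) (col w)) ->
  (forall i f g, f \in blk i -> g \in blk i -> f != g -> ~~ P f g) ->
  (forall i j, i != j -> \sum_(f in blk i) \sum_(g in blk j) (P f g : nat) = t) ->
  npairs Q = ('C(k, 2) * t)%N.
Proof.
move=> QP P0 Pt; rewrite (npairs_pair_sum (P := P)) // csE.
rewrite (pair_sum_blocks (t := t)) ?enum_uniq // => [|i|i j ne].
- by rewrite size_enum_ord -[LHS]mulr_natl natn.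
- apply: pair_sum_eq0; first exact: enum_uniq.
  by move=> f g; rewrite !mem_enum => fB gB ne; rewrite (negPf (P0 i f g fB gB ne)).
rewrite big_enum -[RHS](Pt i j ne) /=; apply: eq_bigr => f _.
by rewrite big_enum.
Qed.

Lemma all_pairs_juxta (P : pfun F n -> pfun F n -> bool) :
  (forall i f g, f \in blk i -> g \in blk i -> f != g -> P f g) ->
  (forall i j f g, i != j -> f \in blk i -> g \in blk j -> P f g) ->
  forall v w : 'I_(size cs), (v < w)%N -> P (col v) (col w).
Proof.
move=> P0 P1 v w lt_vw.
have H : npairs (fun v w => ~~ P (col v) (col w)) = 0%N.
  rewrite (npairs_juxta (P := fun f g => ~~ P f g) (t := 0)) ?muln0 //.
    by move=> i f g fB gB ne; rewrite negbK (P0 i).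
  move=> i j ne; apply: big1 => f fB; apply: big1 => g gB.
  by rewrite (P1 i j).
by have := npairs0 H lt_vw; rewrite negbK.
Qed.

Lemma sum_juxta_projA2 :
  \sum_(p : 'I_(size cs) * 'I_(size cs) | (p.1 < p.2)%N) projA2 c D p.1 p.2
  = ('C(k, 2) * (N - 1))%:R.
Proof. by rewrite -gwlp2_projA2 ?finNzRing_gt1 // juxta_gwlp2. Qed.

Section Odd.

Hypothesis oddq : odd q.
Hypothesis q_gt2 : (2 < q)%N.

Lemma juxta_odd_values (v w : 'I_(size cs)) : (v < w)%N ->
  projA2 c D v w \in
    [:: 0; (qC - 1) / qC; (qC - 1) ^+ 2 / qC ^+ 2; (qC - 1) / qC ^+ 2].
Proof.
rewrite juxta_projA2; apply: (all_pairs_juxta (P := fun f g => function_A2 C f g \in _)).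
  by move=> i f g fB gB ne; rewrite (fA2_block C (ul i) fB gB ne) mem_head.
move=> i j f g ne; apply: fA2_blocks_odd => //.
by rewrite (inj_eq u_inj).
Qed.

Lemma juxta_odd_npairs1 :
  npairs (fun v w => projA2 c D v w == (qC - 1) / qC) = ('C(k, 2) * (2 * q))%N.
Proof.
have /= := odd_values_uniq C q_gt2; rewrite !inE !negb_or => /andP[/and3P[n1 n2 n3] _].
apply: (npairs_juxta (P := fun f g => function_A2 C f g == (qC - 1) / qC)) => [v w|i f g fB gB ne|i j ne].
- by rewrite juxta_projA2.
- by rewrite (fA2_block C (ul i) fB gB ne).
by apply: sum_blocks_odd1; rewrite // (inj_eq u_inj).
Qed.

Lemma juxta_odd_npairs2 :
  npairs (fun v w => projA2 c D v w == (qC - 1) ^+ 2 / qC ^+ 2) = ('C(k, 2) * q ^ 2)%N.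
Proof.
have /= := odd_values_uniq C q_gt2; rewrite !inE !negb_or => /andP[/and3P[n1 n2 n3] _].
apply: (npairs_juxta (P := fun f g => function_A2 C f g == (qC - 1) ^+ 2 / qC ^+ 2)) => [v w|i f g fB gB ne|i j ne].
- by rewrite juxta_projA2.
- by rewrite (fA2_block C (ul i) fB gB ne).
by apply: sum_blocks_odd2; rewrite // (inj_eq u_inj).
Qed.

(** From the total A_2 and the two other multiplicities. *)
Lemma juxta_odd_npairs3 : (q ^ 2 <= N)%N -> 
  (npairs (fun v w => projA2 c D v w == (qC - 1) / qC ^+ 2) * (q - 1)
   = 'C(k, 2) * (q ^ 2 * (N - q ^ 2)))%N.
Proof.
move=> q2N; have := sum_pairs_values (odd_values_uniq C q_gt2) juxta_odd_values.
rewrite sum_juxta_projA2 !big_cons big_nil mul0r add0r addr0.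
rewrite juxta_odd_npairs1 juxta_odd_npairs2; set n3 := npairs _ => E.
have q0 : qC != 0 := qC_neq0 F C.
apply/eqP; rewrite -(eqr_nat C) !natrM !natrB ?q_gt0 // ?natrX.
rewrite !natrM natrB ?N_gt0 // ?natrX in E.
have -> : n3%:R * (qC - 1) = qC ^+ 2 * ((qC - 1) / qC ^+ 2 * n3%:R) by field.
have {E} -> : (qC - 1) / qC ^+ 2 * n3%:R = 'C(k, 2)%:R * (NC - 1)
  - (qC - 1) / qC * ('C(k, 2)%:R * (2 * qC))
  - (qC - 1) ^+ 2 / qC ^+ 2 * ('C(k, 2)%:R * qC ^+ 2) by rewrite E; ring.
by apply/eqP; field.
Qed.

End Odd.

Section Even.

Hypothesis evq : ~~ odd q.

Lemma col_additive v : fadditive (col v).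
Proof. by have [j] := col_in_block v; apply: (block_additive evq (ul j)). Qed.

Lemma juxta_even_values (v w : 'I_(size cs)) : (v < w)%N ->
  projA2 c D v w \in [:: 0; 1; 3].
Proof.
rewrite juxta_projA2; apply: (all_pairs_juxta (P := fun f g => function_A2 C f g \in _)).
  by move=> i f g fB gB ne; rewrite (fA2_block C (ul i) fB gB ne) mem_head.
move=> i j f g ne fB gB; have neu : u i != u j by rewrite (inj_eq u_inj).
have fD := block_additive evq (ul i) fB; have gD := block_additive evq (ul j) gB.
have small := small_ker_blocks (ul i) (ul j) neu fB gB.
have [[|[|[|//]]] _ [-> _]] := fA2_small_ker C evq fD gD small.
- by rewrite subrr mem_head.
- by rewrite (_ : _ - 1 = 1) ?inE ?eqxx ?orbT //; ring.
by rewrite (_ : _ - 1 = 3) ?inE ?eqxx ?orbT //; ring.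
Qed.

End Even.

Section Four.

Hypothesis q4 : q = 4%N.
Let evq : ~~ odd q. Proof. by rewrite q4. Qed.

Lemma juxta_four_full v w : fully_aliased D v w = (projA2 c D v w == 3).
Proof.
rewrite /fully_aliased (equal_levels_additive hc col_balanced card_dvd_points) ?q_gt0 //.
- by rewrite q4; congr (_ == _); field.
- exact: (col_additive evq).
- exact: (col_additive evq).
Qed.

Lemma juxta_four_orthogonal v w : orthogonal_cols D v w = (projA2 c D v w == 0).
Proof.
rewrite /orthogonal_cols (equal_levels_additive hc col_balanced card_dvd_points).
- by rewrite q4; congr (_ == _); field.
- exact: (col_additive evq).
- exact: (col_additive evq).
by rewrite expn_gt0 q_gt0.
Qed.

Lemma juxta_four_partial (v w : 'I_(size cs)) : (v < w)%N ->
  partially_aliased D v w = (projA2 c D v w == 1).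
Proof.
move=> lt_vw; rewrite /partially_aliased juxta_four_full juxta_four_orthogonal.
have := juxta_even_values evq lt_vw; rewrite !inE.
have n01 : (0 == 1 :> C) = false by rewrite eq_sym oner_eq0.
have n31 : (3 == 1 :> C) = false by rewrite (eqr_nat C 3 1).
by case/or3P => /eqP->; rewrite ?eqxx ?n01 ?n31 ?andbF // oner_eq0 eq_sym n31.
Qed.

Lemma juxta_four_npairs3 : npairs (fun v w => projA2 c D v w == 3) = 'C(k, 2).
Proof.
rewrite -[RHS]muln1.
apply: (npairs_juxta (P := fun f g => function_A2 C f g == 3)) => [v w|i f g fB gB ne|i j ne].
- by rewrite juxta_projA2.
- by rewrite (fA2_block C (ul i) fB gB ne) eq_sym pnatr_eq0.
by apply: sum_full_blocks; rewrite // (inj_eq u_inj).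
Qed.

(** From the total A_2 and the number of pairs with value 3. *)
Lemma juxta_four_npairs1 : (4 <= N)%N ->
  npairs (fun v w => projA2 c D v w == 1) = ('C(k, 2) * (N - 4))%N.
Proof.
move=> N4; have vals_uniq : uniq [:: 0; 1; 3 : C].
  rewrite /= !inE negb_or eq_sym oner_eq0 eq_sym pnatr_eq0 /=.
  by rewrite (eqr_nat C 1 3).
have := sum_pairs_values vals_uniq (juxta_even_values evq).
rewrite sum_juxta_projA2 !big_cons big_nil mul0r add0r mul1r addr0.
rewrite juxta_four_npairs3 => E.
apply/eqP; rewrite -(eqr_nat C) natrM natrB //.
rewrite natrM natrB ?N_gt0 // in E.
by apply/eqP/(addIr (3 * 'C(k, 2)%:R)); rewrite -E; ring.
Qed.

End Four.

Lemma juxta_not_full : (2 < q)%N -> (odd q || (4 < q)%N) ->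
  forall v w : 'I_(size cs), (v < w)%N -> ~~ fully_aliased D v w.
Proof.
move=> q_gt2 q_big v w lt_vw; apply/negP => full.
have q0 : qC != 0 := qC_neq0 F C.
have A2q : projA2 c D v w = qC - 1.
  rewrite (equal_levels_fA2 hc col_balanced card_dvd_points full).
  by congr (_ - 1); field.
have q1 : qC - 1 != 0 by rewrite subr_eq0 (eqr_nat C _ 1) gtn_eqF // (ltn_trans _ q_gt2).
have [oddq|evq] := boolP (odd q).
  have := juxta_odd_values oddq lt_vw; rewrite A2q !inE (negPf q1) /=.
  have neq (x : C) : (qC - 1 - x) * qC ^+ 2 != 0 -> (qC - 1 == x) = false.
    by move=> H; apply/negbTE; apply: contraNneq H => <-; rewrite subrr mul0r.
  have qp : qC + 1 != 0 by rewrite natr1 pnatr_eq0.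
  rewrite !neq //.
  - by rewrite (_ : _ * _ = (qC - 1) ^+ 2 * (qC + 1)) ?mulf_neq0 ?expf_neq0 //; field.
  - rewrite (_ : _ * _ = (qC - 1) * (qC ^+ 2 - (qC - 1))); last by field.
    rewrite mulf_neq0 // (_ : _ - _ = (q * (q - 1)).+1%:R) ?pnatr_eq0 //.
    by rewrite -natr1 natrM natrB ?q_gt0 //; ring.
  by rewrite (_ : _ * _ = (qC - 1) ^+ 2 * qC) ?mulf_neq0 ?expf_neq0 //; field.
have := juxta_even_values evq lt_vw; rewrite A2q !inE (negPf q1) /=.
rewrite !subr_eq (_ : 3 + 1 = 4%:R); last by rewrite natr1.
rewrite !eqr_nat; move: q_big; rewrite (negPf evq) /= => q4.
by rewrite (eqr_nat C _ 2) (gtn_eqF q_gt2) (gtn_eqF q4).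
Qed.

End Juxtaposition.

Theorem theorem6 (R : realType) (s : nat) (F : finFieldType) (hF : #|F| = s)
    (hs : (2 < s)%N)
    (c : 'I_(#|F|.-1) -> F -> R[i]) (hc : orthonormal_contrasts c)
    (n k : nat) (hk : (1 < k <= (s ^ n - 1) %/ (s - 1))%N)
    (h : 'I_k -> {ffun 'rV[F]_n -> F}) (h_inj : injective h)
    (hH : forall i, h i \in Hset (@X_ F n)) :
  let cs := juxta_cols h in
  let D := cols_design cs in
  let A2 := projA2 c D in
  let B := 'C(k, 2) in
  [/\ (* an SSD(s^n, s^m) with m = k (s^n - 1) / (s - 1) *)
      [/\ #|{: 'rV[F]_n}| = (s ^ n)%N,
          size cs = (k * ((s ^ n - 1) %/ (s - 1)))%N
        & balanced D],
      gwlp c D 2 = (B * (s ^ n - 1))%:R,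
      GMA_optimal c D,
      (odd s || (4 < s)%N) ->
        forall u v : 'I_(size cs), (u < v)%N -> ~~ fully_aliased D u v
    & [/\ (* (i) *)
      odd s ->
        [/\ forall u v : 'I_(size cs), (u < v)%N ->
              A2 u v \in [:: 0; (s%:R - 1) / s%:R; (s%:R - 1) ^+ 2 / s%:R ^+ 2;
                             (s%:R - 1) / s%:R ^+ 2],
            npairs (fun u v => A2 u v == (s%:R - 1) / s%:R) = (B * (2 * s))%N,
            npairs (fun u v => A2 u v == (s%:R - 1) ^+ 2 / s%:R ^+ 2)
              = (B * s ^ 2)%N
          & npairs (fun u v => A2 u v == (s%:R - 1) / s%:R ^+ 2)
              = (B * (s ^ 2 * (s ^ n - s ^ 2) %/ (s - 1)))%N],
      (* (ii) *)
      ~~ odd s ->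
        forall u v : 'I_(size cs), (u < v)%N -> A2 u v \in [:: 0; 1; 2%:R; 3%:R]
    & (* (iii) *)
      s = 4%N ->
        [/\ forall u v : 'I_(size cs), (u < v)%N -> A2 u v \in [:: 0; 1; 3%:R],
            forall u v : 'I_(size cs), (u < v)%N -> fully_aliased D u v = (A2 u v == 3%:R),
            forall u v : 'I_(size cs), (u < v)%N -> partially_aliased D u v = (A2 u v == 1),
            npairs (fun u v => fully_aliased D u v) = B
          & npairs (fun u v => partially_aliased D u v) = (B * (4 ^ n - 4))%N]]].
Proof.
subst s.
have [u [l [ul hE]]] : exists (u : 'I_k -> 'rV[F]_n) (l : 'I_k -> 'I_n),
    (forall i, is_last (u i) (l i)) /\ (forall i, h i = lform (u i)).
  have ex i : exists p : 'rV[F]_n * 'I_n, is_last p.1 p.2 /\ h i = lform p.1.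
    have := hH i; rewrite Hset_coord => /imsetP[d].
    by rewrite inE => /normalizedP[l dl] ->; exists (d, l).
  have [p hp] := fin_all_exists ex.
  by exists (fun i => (p i).1), (fun i => (p i).2); split=> i; case: (hp i).
have u_inj : injective u by move=> i j Eij; apply: h_inj; rewrite !hE Eij.
set cs := juxta_cols h.
have csE : cs = flatten [seq enum (block (u i) (l i)) | i <- enum 'I_k].
  by rewrite /cs /juxta_cols; congr flatten; apply: eq_map => i; rewrite hE (Qh_block (ul i)).
clearbody cs; move=> cs' D A2 B.
have [k_gt1 le_k] := andP hk; have k_gt0 := ltnW k_gt1.
have EN : #|{: 'rV[F]_n}| = (#|F| ^ n)%N by rewrite card_mx mul1n.
have q_gt0 : (0 < #|F|)%N := ltnW (ltnW hs).
have q1_gt0 : (0 < #|F| - 1)%N by rewrite subn_gt0 ltnW.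
(* There is only one normalized form in one variable, and none in zero. *)
have n_gt1 : (1 < n)%N.
  have := leq_trans k_gt1 le_k; case: (ltngtP n 1) => // [|->].
    by rewrite ltnS leqn0 => /eqP->; rewrite subnn div0n.
  by rewrite expn1 divnn q1_gt0.
have q2N : (#|F| ^ 2 <= #|{: 'rV[F]_n}|)%N by rewrite EN leq_pexp2l.
have Qd : (#|F| - 1 %| #|F| ^ n - 1)%N by rewrite !subn1 dvdn_pred_predX.
split.
- split=> //; last exact: (juxta_balanced ul csE).
  apply/eqP; rewrite -(eqn_pmul2r q1_gt0) -mulnA divnK // [(_ - 1)%N in X in X == _]subn1.
  by rewrite (size_juxta ul csE) EN subn1.
- by rewrite (juxta_gwlp2 hc ul csE k_gt0) EN.
- exact: (juxta_GMA hc ul csE k_gt0).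
- exact: (juxta_not_full hc ul u_inj csE k_gt0).
split.
- move=> oddq; split.
  + exact: (juxta_odd_values hc ul u_inj csE k_gt0).
  + exact: (juxta_odd_npairs1 hc ul u_inj csE k_gt0).
  + exact: (juxta_odd_npairs2 hc ul u_inj csE k_gt0).
  have Qd2 : (#|F| - 1 %| #|F| ^ 2 * (#|F| ^ n - #|F| ^ 2))%N.
    have -> : (#|F| ^ n - #|F| ^ 2 = (#|F| ^ (n - 2) - 1) * #|F| ^ 2)%N.
      by rewrite mulnBl mul1n -expnD subnK.
    by rewrite !subn1 dvdn_mull // dvdn_mulr // dvdn_pred_predX.
  apply/eqP; rewrite -(eqn_pmul2r q1_gt0) -mulnA (divnK Qd2).
  by rewrite (juxta_odd_npairs3 hc ul u_inj csE k_gt0 oddq hs q2N) EN.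
- move=> evq v w lt_vw; have := juxta_even_values hc ul u_inj csE k_gt0 evq lt_vw.
  by rewrite !inE => /or3P[] ->; rewrite ?orbT.
move=> q4; have evq : ~~ odd #|F| by rewrite q4.
have N4 : (4 <= #|{: 'rV[F]_n}|)%N by rewrite (leq_trans _ q2N) // q4.
have full v w := juxta_four_full hc ul csE k_gt0 q4 v w.
split.
- exact: (juxta_even_values hc ul u_inj csE k_gt0 evq).
- by move=> v w _; apply: full.
- exact: (juxta_four_partial hc ul u_inj csE k_gt0 q4).
- transitivity (npairs (fun v w => A2 v w == 3)); last first.
    exact: (juxta_four_npairs3 hc ul u_inj csE k_gt0 q4).
  by apply: eq_card => p; rewrite !inE full.
transitivity (npairs (fun v w => A2 v w == 1)).
  apply: eq_card => -[v w]; rewrite !inE /=; case lt_vw: (v < w)%N => //=.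
  exact: (juxta_four_partial hc ul u_inj csE k_gt0 q4).
by rewrite (juxta_four_npairs1 hc ul u_inj csE k_gt0 q4 N4) EN q4.
Qed.
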